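(* Let $\{X_k=e^{i\tau_k}R_k\}_{k\ge1}$ be as in the context, and let $\mathrm{HMC}_1$ be the associated critical holomorphic multiplicative chaos. (a) If there is some $\gamma>2$ such that $\mathbb{E}[e^{\gamma|X_1|}]<\infty$, then for every $s<-1/2$, $\mathrm{HMC}_1\in H^s$ almost surely. (b) If for some $\gamma\in(0,2]$ one has $\mathbb{P}(|X_k|\ge u)=\min\{1,\exp(-\gamma(u-c_\gamma))\}$ for $u>0$, with $c_\gamma$ the normalizing shift given in the context, then for every $s<-1/\gamma$, $\mathrm{HMC}_1\in H^s$ almost surely.
   Context: $\{\tau_k\}_{k\ge1}$ are i.i.d. uniform on $[-\pi,\pi)$; $\{R_k\}_{k\ge1}$ are i.i.d. real symmetric random variables with $\mathbb{E}[R_k^2]=1$, independent of $\{\tau_k\}$; and $X_k=e^{i\tau_k}R_k$. $\mathrm{HMC}_1$ is the random distribution on the unit circle given on trigonometric polynomials $\phi$ by $(\mathrm{HMC}_1,\phi)=\lim_{r\uparrow1}\frac1{2\pi}\int_{-\pi}^{\pi}\exp\big(\sum_{k\ge1}\frac{X_k}{\sqrt k}(re^{i\theta})^k\big)\overline{\phi(\theta)}\,d\theta$; its Fourier coefficients are $A_n=[z^n]\exp\big(\sum_{k\ge1}\frac{X_k}{\sqrt k}z^k\big)$ for $n\ge0$ and $0$ for $n<0$. $\mathrm{HMC}_1\in H^s$ means $\sum_{n=0}^\infty(1+n^2)^s|A_n|^2<\infty$. The constant $c_\gamma\in\mathbb{R}$ is the one for which the tail in (b) yields $\mathbb{E}[|X_k|^2]=1$: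 $c_\gamma=\gamma^{-1}\log(\gamma^2/2)$ if $\gamma\le\sqrt2$, and $c_\gamma=\gamma^{-1}(\sqrt{\gamma^2-1}-1)$ if $\gamma>\sqrt2$. *)

(* Defs.v *)
From HB Require Import structures.
From mathcomp Require Import all_boot all_order all_algebra.
From mathcomp Require Import all_classical all_reals all_analysis.
From mathcomp Require Export complex.

Set Implicit Arguments.
Unset Strict Implicit.
Unset Printing Implicit Defensive.

Import Order.TTheory GRing.Theory Num.Theory.
Import numFieldNormedType.Exports.
Import ComplexField.Normc.

Local Open Scope classical_set_scope.
Local Open Scope ring_scope.
Local Open Scope complex_scope.

(* Sequences (tau_k), (R_k), (X_k) indexed by k >= 1 are represented by
   functions on nat with index shifted by one: the value at k : nat is the
   term of index k.+1. *)

Section Independence.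
Context d (T : measurableType d) (R : realType) (P : probability T R).
Implicit Type Y Z : nat -> {RV P >-> R}.

Definition mutually_independent Y :=
  forall (J : seq nat) (B : nat -> set R), uniq J ->
    (forall k, measurable (B k)) ->
    P (\bigcap_(k in [set` J]) Y k @^-1` B k) =
    (\prod_(k <- J) P (Y k @^-1` B k))%E.

Definition identically_distributed Y :=
  forall (j k : nat) (B : set R), measurable B ->
    distribution P (Y j) B = distribution P (Y k) B.

Definition iid Y := mutually_independent Y /\ identically_distributed Y.

Definition sigma_family Y : set (set T) :=
  <<s \bigcup_k preimage_set_system setT (Y k) measurable >>.

Definition independent_families Y Z :=
  forall A B : set T, sigma_family Y A -> sigma_family Z B ->
    P (A `&` B) = (P A * P B)%E.

Definition symmetric_RV (Y : {RV P >-> R}) :=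
  forall B : set R, measurable B ->
    P (Y @^-1` B) = P ((fun w => - Y w) @^-1` B).

End Independence.

Lemma ltNpipi (R : realType) : - pi < pi :> R.
Proof. by rewrite gtrN // pi_gt0. Qed.

(* The library's uniform law lives on the closed interval [-pi, pi]; as a law
   it coincides with the uniform law on [-pi, pi). *)
Definition uniform_angle d (T : measurableType d) (R : realType)
    (P : probability T R) (Y : {RV P >-> R}) :=
  forall B : set R, measurable B ->
    distribution P Y B = uniform_prob (ltNpipi R) B.

Definition hmc_input d (T : measurableType d) (R : realType)
    (P : probability T R) (tau Rad : nat -> {RV P >-> R}) :=
  [/\ iid tau /\ (forall k, uniform_angle (tau k)),
      iid Rad /\ (forall k, symmetric_RV (Rad k)),
      forall k, ('E_P[fun w => (Rad k w ^+ 2)%R] = 1)%E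
    & independent_families Rad tau].

Section HMC.
Variable R : realType.

Definition expi (t : R) : R[i] := cos t +i* sin t.

Definition hmcX (T : Type) (tau Rad : nat -> T -> R) (k : nat) (w : T) : R[i] :=
  expi (tau k w) * (Rad k w)%:C.

(* [z^n] exp (\sum_(k >= 0) a k z^k), for a 0 = 0. Since the argument has no
   constant term, its j-th power contributes to [z^n] only for j <= n, and only
   its coefficients of index <= n matter. *)
Definition coef_exp (a : nat -> R[i]) (n : nat) : R[i] :=
  \sum_(j < n.+1) ((\poly_(k < n.+1) a k) ^+ j)`_n / j`!%:R.

(* The coefficients X_k / sqrt k of the exponent. *)
Definition hmc_exponent (X : nat -> R[i]) (k : nat) : R[i] :=
  if k is m.+1 then X m / (Num.sqrt (m.+1%:R : R))%:C else 0.

(* The Fourier coefficient A_n of HMC_1, n >= 0; those of index n < 0 vanish. *)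
Definition hmc_coef (X : nat -> R[i]) (n : nat) : R[i] :=
  coef_exp (hmc_exponent X) n.

Definition HMC1_in_H (s : R) (X : nat -> R[i]) : Prop :=
  (\sum_(0 <= n <oo)
     (((1 + n%:R ^+ 2) `^ s * normc (hmc_coef X n) ^+ 2)%R)%:E < +oo)%E.

Definition c_shift (g : R) : R :=
  if g <= Num.sqrt 2 then g^-1 * ln (g ^+ 2 / 2)
  else g^-1 * (Num.sqrt (g ^+ 2 - 1) - 1).

End HMC.

(* Main.v *)
From HB Require Import structures.
Require Import Defs.
From mathcomp Require Import all_boot all_order all_algebra.
From mathcomp Require Import all_classical all_reals all_analysis.
From mathcomp Require Import measurable_realfun complex.
From mathcomp Require Import ring lra.

Set Implicit Arguments.
Unset Strict Implicit.
Unset Printing Implicit Defensive.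

Import Order.TTheory GRing.Theory Num.Theory.
Import numFieldNormedType.Exports.
Import ComplexField.Normc.

Local Open Scope classical_set_scope.
Local Open Scope ring_scope.

(** Both parts follow from [hmc_sobolev]: almost surely HMC_1 lies in H^s for
    every s < -1/2. In (b) this covers the claim because g <= 2 gives
    -1/g <= -1/2.

    Let a_k = X_k / sqrt k be the coefficients of the exponent. First suppose
    that |a_k| <= 1. Expanding the exponential writes A_n as a sum, over the
    multiplicity functions m with \sum_k k m_k = n, of the monomials
    \prod_k a_k^{m_k} / m_k! ([coef_exp_weight]). The angles are independent and
    uniform, so distinct monomials are orthogonal in L^2 ([cE_monomials]), and
      E|A_n|^2 = \sum_m \prod_k E|a_k|^{2 m_k} / m_k!^2   ([second_moment]).
    Summing over n <= N releases the constraint on m and leaves a product over k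
    of \sum_j E|a_k|^{2j} / j!^2 <= (1 + 1/k) exp (e E|a_k|^4). The factors
    1 + 1/k telescope to N + 1, so \sum_(n <= N) E|A_n|^2 = O(N) as soon as
    \sum_k E|a_k|^4 is finite ([second_moment_sum]). A dyadic decomposition then
    gives \sum_n (1 + n^2)^s E|A_n|^2 < oo for s < -1/2
    ([linear_growth_summable]), hence almost sure finiteness of the random sum.

    The assumption |a_k| <= 1 is obtained by a cutoff: R_k is replaced by 0 when
    R_k^2 > k. Since \sum_(k >= u) 1/k^2 = O(1/u), the fourth moments of the cut
    off coefficients sum to at most 2 E[R^2] = 2
    ([moment_scaled_cutoff2_sum]). On the other hand
    \sum_k P(R_k^2 > k) <= E[R^2], so almost surely the cutoff changes only
    finitely many X_k ([ae_eventually_small]). Such a change multiplies the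
    generating function by the exponential of a polynomial, whose coefficients
    are in l^1. Convolution with an l^1 sequence preserves H^s for s <= 0, by
    Young's inequality with the nonincreasing weight (1 + n^2)^s
    ([HMC1_in_H_finite_change]). *)

(** * Truncated exponentials of polynomials *)

Lemma sum_antidiag (V : nmodType) N (f : nat -> nat -> V) n : (n < N)%N ->
  \sum_(i < n.+1) f i (n - i)%N = \sum_(i < N) \sum_(l < N | (i + l)%N == n) f i l.
Proof.
move=> nN; rewrite (big_ord_widen N (fun i => f i (n - i)%N)) // big_mkcond.
apply: eq_bigr => i _; case: ifP => i_n; last first.
  rewrite big1 // => l /eqP e; move: i_n; rewrite -e ltnS.
  by rewrite leq_addr.
have jl : (n - i < N)%N by apply: leq_ltn_trans (leq_subr _ _) nN.
rewrite (big_pred1 (Ordinal jl)) // => l /=.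
apply/eqP/eqP => [e|->]; first by apply: val_inj => /=; rewrite -e addKn.
by rewrite /= subnKC.
Qed.

Section TruncatedExponential.
Variable F : numFieldType.
Implicit Types (p q : {poly F}) (N : nat).

(** Power series are handled as polynomials modulo [X^(N+1)]. *)
Definition eq_upto N p q := forall i, (i <= N)%N -> p`_i = q`_i.

Lemma eq_uptoM N p p' q q' :
  eq_upto N p p' -> eq_upto N q q' -> eq_upto N (p * q) (p' * q').
Proof.
move=> epp' eqq' i iN; rewrite !coefM; apply: eq_bigr => j _.
rewrite epp' ?eqq' //; first exact: leq_trans (leq_subr _ _) iN.
by apply: leq_trans iN; rewrite -ltnS ltn_ord.
Qed.

Lemma eq_uptoX N p q j : eq_upto N p q -> eq_upto N (p ^+ j) (q ^+ j).
Proof. by move=> epq; elim: j => [//|j IH]; rewrite !exprS; apply: eq_uptoM. Qed.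

Lemma coef_exp_low p j i : p`_0 = 0 -> (i < j)%N -> (p ^+ j)`_i = 0.
Proof.
move=> p0; have -> : p = 'X * drop_poly 1 p.
  apply/polyP => -[|k]; rewrite coefXM //= coef_drop_poly ?addn1 //.
by rewrite exprMn coefXnM => ->.
Qed.

Definition expT N p : {poly F} := \sum_(j < N.+1) (j`!%:R)^-1 *: p ^+ j.

(** The binomial theorem turns the left side into the terms
    p^l q^i / (l! i!) with i + l <= N; the terms of the product with i + l > N
    are divisible by [X^(N+1)] because p and q have no constant term. *)
Lemma expTD N p q : p`_0 = 0 -> q`_0 = 0 ->
  eq_upto N (expT N (p + q)) (expT N p * expT N q).
Proof.
move=> p0 q0 n nN.
pose f (i l : nat) : {poly F} := (i`!%:R * l`!%:R)^-1 *: (p ^+ l * q ^+ i).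
have -> : expT N (p + q) =
    \sum_(i < N.+1) \sum_(l < N.+1 | (i + l < N.+1)%N) f i l.
  transitivity (\sum_(j < N.+1) \sum_(i < N.+1) \sum_(l < N.+1 | (i + l)%N == j) f i l).
    apply: eq_bigr => j _; rewrite exprDn scaler_sumr.
    rewrite -sum_antidiag //; apply: eq_bigr => i _; have ij := leq_ord i.
    rewrite /f -[X in _ *: X]scaler_nat scalerA; congr (_ *: _).
    rewrite -(bin_fact ij) !natrM.
    have C0 : ('C(j, i)%:R : F) != 0 by rewrite pnatr_eq0 -lt0n bin_gt0.
    by rewrite invfM mulrC mulrA mulfV // mul1r.
  rewrite exchange_big; apply: eq_bigr => i _ /=.
  rewrite (exchange_big_dep xpredT) //= [RHS]big_mkcond; apply: eq_bigr => l _.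
  case: ifP => il; last by rewrite big1 // => j /eqP e; move: (ltn_ord j); rewrite -e il.
  by rewrite (big_pred1 (Ordinal il)) // => j; rewrite eq_sym.
have -> : expT N p * expT N q = \sum_(i < N.+1) \sum_(l < N.+1) f i l.
  rewrite /expT big_distrlr exchange_big; apply: eq_bigr => i _; apply: eq_bigr => l _.
  by rewrite /f /= -scalerAl -scalerAr scalerA invfM mulrC.
rewrite !coef_sum; apply: eq_bigr => i _; rewrite !coef_sum.
rewrite big_mkcond; apply: eq_bigr => l _; case: ifPn => // il.
rewrite coefZ coefM big1 ?mulr0 // => k _.
have [kl|kl] := ltnP k l; first by rewrite coef_exp_low ?mul0r.
rewrite (@coef_exp_low q) ?mulr0 //.
rewrite -leqNgt in il.
have := leq_trans nN (leq_trans (leqnSn N) il).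
rewrite ltn_subLR ?(leq_ord k) // => nil.
rewrite addnC; apply: leq_ltn_trans nN _.
by apply: leq_trans il _; rewrite leq_add2l.
Qed.

Lemma expT0 N : expT N 0 = 1.
Proof.
rewrite /expT big_ord_recl expr0 fact0 invr1 scale1r big1 ?addr0 // => i _.
by rewrite expr0n /= scaler0.
Qed.

Lemma expT_sum N (I : Type) (r : seq I) (p : I -> {poly F}) :
  (forall i, (p i)`_0 = 0) ->
  eq_upto N (expT N (\sum_(i <- r) p i)) (\prod_(i <- r) expT N (p i)).
Proof.
move=> p0; elim: r => [|i r IH]; first by rewrite !big_nil expT0.
rewrite !big_cons => k kN; rewrite expTD //.
  by apply: eq_uptoM kN.
by rewrite coef_sum big1.
Qed.

(** The coefficient of index n does not depend on the truncation order N >= n,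
    which lets all coefficients up to N be read off one polynomial. *)
Lemma expT_coef N (a : nat -> F) n : a 0%N = 0 -> (n <= N)%N ->
  (expT N (\poly_(k < N.+1) a k))`_n =
  \sum_(j < n.+1) ((\poly_(k < n.+1) a k) ^+ j)`_n / j`!%:R.
Proof.
move=> a0 nN; rewrite /expT coef_sum (big_ord_widen N.+1
  (fun j : nat => ((\poly_(k < n.+1) a k) ^+ j)`_n / j`!%:R)) //.
rewrite [RHS]big_mkcond; apply: eq_bigr => j _; rewrite coefZ mulrC.
have e : ((\poly_(k < N.+1) a k) ^+ j)`_n = ((\poly_(k < n.+1) a k) ^+ j)`_n.
  apply: (@eq_uptoX n _ _ j) => // i i_n; rewrite !coef_poly !ltnS i_n.
  by rewrite (leq_trans i_n nN).
case: ifPn; rewrite e // -leqNgt => nj.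
by rewrite coef_exp_low ?mul0r // coef_poly a0.
Qed.

(** The number k.+1 is the exponent attached to index k, so [weight m] is the
    size of the integer partition in which the part k.+1 occurs m k times. *)
Definition weight K M (m : {ffun 'I_K -> 'I_M}) := (\sum_(k < K) k.+1 * m k)%N.

(** The exponential of the sum of the a k z^k is the product of their
    exponentials; distributing the product over the inner sums gives one
    monomial for each multiplicity function. *)
Lemma expT_coef_weight N (a : nat -> F) n : a 0%N = 0 -> (n <= N)%N ->
  (expT N (\poly_(k < N.+1) a k))`_n =
  \sum_(m : {ffun 'I_N -> 'I_N.+1} | weight m == n)
     \prod_(k < N) (a k.+1 ^+ m k / (m k)`!%:R).
Proof.
move=> a0 nN.
have -> : \poly_(k < N.+1) a k = \sum_(k < N) a k.+1 *: 'X^(k.+1).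
  by rewrite poly_def big_ord_recl a0 scale0r add0r.
rewrite expT_sum //; last by move=> k; rewrite coefZ coefXn mulr0.
have -> : \prod_(k < N) expT N (a k.+1 *: 'X^(k.+1)) =
  \prod_(k < N) \sum_(j < N.+1) (a k.+1 ^+ j / j`!%:R) *: 'X^(k.+1 * j).
  apply: eq_bigr => k _; apply: eq_bigr => j _.
  by rewrite exprZn scalerA exprM mulrC.
rewrite bigA_distr_bigA /= coef_sum [RHS]big_mkcond; apply: eq_bigr => m _.
rewrite scaler_prod coefZ prodrXr coefXn.
by rewrite eq_sym /weight; case: ifP => _; rewrite ?mulr1 ?mulr0.
Qed.

End TruncatedExponential.

Lemma sum_by_weight (R : numDomainType) K M N (G : {ffun 'I_K -> 'I_M} -> R) :
  (forall m, 0 <= G m) ->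
  \sum_(n < N) \sum_(m | weight m == n) G m <= \sum_m G m.
Proof.
move=> G0; rewrite (exchange_big_dep xpredT) //=; apply: ler_sum => m _.
have [h|h] := ltnP (weight m) N; first by rewrite (big_pred1 (Ordinal h)).
rewrite big1 // => n /eqP e; move: (ltn_ord n); rewrite -e ltnNge h //.
Qed.

(** * Coefficients of exponentials, and stability of Sobolev membership *)

Section Norm.
Variable R : realType.

Lemma normc_ge0 (x : R[i]) : 0 <= normc x.
Proof. by case: x => a b; apply: sqrtr_ge0. Qed.

Lemma normc_realE (r : R) : normc (r%:C)%C = `|r|.
Proof. by rewrite /= expr0n /= addr0 sqrtr_sqr. Qed.

Lemma normc_natE n : normc (n%:R : R[i]) = n%:R.
Proof. by rewrite -[n%:R](rmorph_nat (real_complex R)) normc_realE ger0_norm. Qed.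

Lemma normc_sum I (r : seq I) (p : pred I) (f : I -> R[i]) :
  normc (\sum_(i <- r | p i) f i) <= \sum_(i <- r | p i) normc (f i).
Proof.
elim/big_ind2 : _ => //; first by rewrite normc0.
by move=> x1 x2 y1 y2 h1 h2; apply: le_trans (le_normcD _ _) (lerD h1 h2).
Qed.

Lemma normc_prod I (r : seq I) (f : I -> R[i]) :
  normc (\prod_(i <- r) f i) = \prod_(i <- r) normc (f i).
Proof. by apply: (big_morph _ (@normcM _)); rewrite normc1. Qed.

Lemma normcX (x : R[i]) n : normc (x ^+ n) = normc x ^+ n.
Proof. by elim: n => [|n IH]; rewrite ?normc1 // !exprS normcM IH. Qed.

End Norm.

Section CoefExp.
Variable R : realType.
Implicit Types a b c : nat -> R[i].

Lemma coef_expE N a n : a 0%N = 0 -> (n <= N)%N ->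
  coef_exp a n = (expT N (\poly_(k < N.+1) a k))`_n.
Proof. by move=> a0 nN; rewrite expT_coef. Qed.

Lemma coef_expD a b n : a 0%N = 0 -> b 0%N = 0 ->
  coef_exp (fun k => a k + b k) n =
  \sum_(i < n.+1) coef_exp a i * coef_exp b (n - i).
Proof.
move=> a0 b0; rewrite (@coef_expE n) // ?a0 ?b0 ?addr0 //.
have -> : \poly_(k < n.+1) (a k + b k) =
    \poly_(k < n.+1) a k + \poly_(k < n.+1) b k.
  by apply/polyP => k; rewrite coefD !coef_poly; case: ifP; rewrite ?addr0.
rewrite expTD ?coef_poly //= coefM; apply: eq_bigr => i _.
by rewrite -!coef_expE // ?leq_subr // leq_ord.
Qed.

Lemma coef_exp_weight N a n : a 0%N = 0 -> (n <= N)%N ->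
  coef_exp a n = \sum_(m : {ffun 'I_N -> 'I_N.+1} | weight m == n)
     \prod_(k < N) (a k.+1 ^+ m k / (m k)`!%:R).
Proof. by move=> a0 nN; rewrite (coef_expE a0 nN) expT_coef_weight. Qed.

Lemma exp_partial_le (x : R) N : 0 <= x ->
  \sum_(j < N) x ^+ j / j`!%:R <= expR x.
Proof.
move=> x0; have -> : \sum_(j < N) x ^+ j / j`!%:R = series (exp_coeff x) N.
  by rewrite /series /= big_mkord.
apply: nondecreasing_cvgn_le.
  apply/nondecreasing_seqP => n; rewrite /series /= big_nat_recr //= lerDl.
  by rewrite exp_coeff_ge0.
exact: is_cvg_series_exp_coeff.
Qed.

(** Dominating each monomial by its modulus and dropping the constraint on the
    weight bounds the l^1 norm by the product of the exponentials of the
    moduli. *)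
Lemma coef_exp_l1 c N : c 0%N = 0 ->
  \sum_(n < N) normc (coef_exp c n) <= expR (\sum_(k < N) normc (c k.+1)).
Proof.
move=> c0; pose G (m : {ffun 'I_N -> 'I_N.+1}) : R :=
  \prod_(k < N) (normc (c k.+1) ^+ m k / (m k)`!%:R).
have G0 m : 0 <= G m.
  by apply: prodr_ge0 => k _; rewrite divr_ge0 ?exprn_ge0 ?normc_ge0.
apply: le_trans (_ : \sum_(n < N) \sum_(m | weight m == n) G m <= _).
  apply: ler_sum => n _; rewrite (@coef_exp_weight N) // ?(ltnW (ltn_ord n)) //.
  apply: le_trans (normc_sum _ _ _) _; apply: ler_sum => m _.
  rewrite normc_prod ler_prod // => k _; rewrite normc_ge0 normcM normcX normcV.
  by rewrite /= normc_natE lexx.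
apply: le_trans (sum_by_weight _ G0) _.
rewrite /G -(bigA_distr_bigA (fun (k : 'I_N) (j : 'I_N.+1) =>
   normc (c k.+1) ^+ j / j`!%:R)) expR_sum.
apply: ler_prod => k _; rewrite exp_partial_le ?normc_ge0 // andbT.
by apply: sumr_ge0 => j _; rewrite divr_ge0 ?exprn_ge0 ?normc_ge0.
Qed.

End CoefExp.

Section Young.
Variable R : realType.

(** Lagrange's identity: the difference of the two sides is half the sum of the
    c_i c_j (b_i - b_j)^2. *)
Lemma cauchy_schwarz_sum n (c b : 'I_n -> R) : (forall i, 0 <= c i) ->
  (\sum_i c i * b i) ^+ 2 <= (\sum_i c i) * (\sum_i c i * b i ^+ 2).
Proof.
move=> c0.
have : 0 <= \sum_i \sum_j c i * c j * (b i - b j) ^+ 2.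
  by apply: sumr_ge0 => i _; apply: sumr_ge0 => j _;
    rewrite mulr_ge0 ?sqr_ge0 ?mulr_ge0.
have -> : \sum_i \sum_j c i * c j * (b i - b j) ^+ 2 =
   2 * ((\sum_i c i) * (\sum_i c i * b i ^+ 2) - (\sum_i c i * b i) ^+ 2).
  have e : (\sum_i c i) * (\sum_i c i * b i ^+ 2) =
           (\sum_i c i * b i ^+ 2) * (\sum_i c i) by rewrite mulrC.
  rewrite mulr_natl mulr2n {1}e expr2 !big_distrlr /= -!sumrB -big_split /=.
  apply: eq_bigr => i _; rewrite -!sumrB -big_split /=; apply: eq_bigr => j _.
  by rewrite sqrrB; ring.
by rewrite pmulr_rge0 // subr_ge0.
Qed.

(** Young's inequality for the convolution of l^1 with a weighted l^2 space.
    Since w is nonincreasing, w n <= w (n - i), so the weight can be moved onto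
    the second factor. *)
Lemma young_weighted (w c b : nat -> R) (M : R) N :
  (forall n, 0 <= w n) -> (forall m n, (m <= n)%N -> w n <= w m) ->
  (forall n, 0 <= c n) -> (forall n, \sum_(i < n) c i <= M) ->
  \sum_(n < N) w n * (\sum_(i < n.+1) c i * b (n - i)%N) ^+ 2 <=
  M ^+ 2 * \sum_(n < N) w n * b n ^+ 2.
Proof.
move=> w0 wd c0 cM.
have M0 : 0 <= M by have := cM 0%N; rewrite big_ord0.
pose g n := w n * b n ^+ 2.
have g0 n : 0 <= g n by rewrite mulr_ge0 ?sqr_ge0.
apply: (@le_trans _ _ (M * \sum_(n < N) \sum_(i < n.+1) c i * g (n - i)%N)).
  rewrite mulr_sumr; apply: ler_sum => n _.
  apply: le_trans (ler_wpM2l (w0 n) (cauchy_schwarz_sum (fun i : 'I_n.+1 => b (n - i)%N)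
     (fun i : 'I_n.+1 => c0 i))) _.
  rewrite mulrCA; apply: ler_pM => //.
  - by apply: sumr_ge0.
  - by rewrite mulr_ge0 //; apply: sumr_ge0 => i _; rewrite mulr_ge0 ?sqr_ge0.
  rewrite mulr_sumr; apply: ler_sum => i _; rewrite mulrCA ler_wpM2l //.
  by rewrite ler_wpM2r ?sqr_ge0 // wd // leq_subr.
rewrite expr2 -mulrA ler_wpM2l //.
apply: (@le_trans _ _ ((\sum_(i < N) c i) * \sum_(n < N) g n)); last first.
  by rewrite ler_wpM2r // sumr_ge0.
rewrite big_distrlr /=.
under eq_bigr => n _ do rewrite (sum_antidiag (fun i l => c i * g l) (ltn_ord n)).
rewrite exchange_big; apply: ler_sum => i _ /=.
rewrite (exchange_big_dep xpredT) //=; apply: ler_sum => l _.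
have [h|h] := ltnP (i + l) N; first by rewrite (big_pred1 (Ordinal h)) // => j; rewrite eq_sym.
rewrite big1 => [|j /eqP e]; first exact: mulr_ge0 (c0 _) (g0 _).
by move: (ltn_ord j); rewrite -e ltnNge h.
Qed.

End Young.

Section Sobolev.
Variable R : realType.

Lemma nneseries_bounded (u : nat -> R) : (forall n, 0 <= u n) ->
  (\sum_(0 <= n <oo) (u n)%:E < +oo)%E <->
  exists M, forall N, \sum_(n < N) u n <= M.
Proof.
move=> u0; split=> [h|[M uM]].
  have s0 : (0 <= \sum_(0 <= n <oo) (u n)%:E)%E.
    by apply: nneseries_ge0 => n _ _; rewrite lee_fin.
  exists (fine (\sum_(0 <= n <oo) (u n)%:E)%E) => N.
  rewrite -lee_fin fineK ?ge0_fin_numE // -sumEFin.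
  rewrite -(big_mkord xpredT (fun n => (u n)%:E)).
  by apply: nneseries_lim_ge => n _ _; rewrite lee_fin.
apply: le_lt_trans (ltry M); apply: lime_le.
  by apply: is_cvg_nneseries => n _ _; rewrite lee_fin.
by apply: nearW => N; rewrite big_mkord sumEFin lee_fin.
Qed.

Definition sobolev_weight (s : R) n : R := (1 + n%:R ^+ 2) `^ s.

Lemma sobolev_weight_ge0 s n : 0 <= sobolev_weight s n.
Proof. exact: powR_ge0. Qed.

Lemma sobolev_weight_anti s m n : s <= 0 -> (m <= n)%N ->
  sobolev_weight s n <= sobolev_weight s m.
Proof.
move=> s0 mn; rewrite /sobolev_weight -[s]opprK !(powRN _ (- s)).
have p k : 0 < (1 + k%:R ^+ 2 : R) by rewrite ltr_pwDl ?ltr01 ?sqr_ge0.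
rewrite lef_pV2 ?posrE ?powR_gt0 //; apply: ge0_ler_powR.
- by rewrite oppr_ge0.
- by rewrite nnegrE ltW.
- by rewrite nnegrE ltW.
by rewrite lerD2l lerXn2r ?nnegrE ?ler_nat.
Qed.

Lemma HMC1_in_HP s (X : nat -> R[i]) :
  HMC1_in_H s X <-> exists M, forall N,
    \sum_(n < N) sobolev_weight s n * normc (hmc_coef X n) ^+ 2 <= M.
Proof.
by apply: nneseries_bounded => n; rewrite mulr_ge0 ?sqr_ge0 ?powR_ge0.
Qed.

(** The exponents differ by a polynomial c, so the coefficients of X are the
    convolution of those of Y with the summable sequence [coef_exp c]. *)
Lemma HMC1_in_H_finite_change s K (X Y : nat -> R[i]) : s <= 0 ->
  (forall k, (K <= k)%N -> X k = Y k) ->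
  HMC1_in_H s Y -> HMC1_in_H s X.
Proof.
move=> s0 XY /HMC1_in_HP[M hM]; apply/HMC1_in_HP.
pose c k := hmc_exponent X k - hmc_exponent Y k.
have c0 : c 0%N = 0 by rewrite /c subrr.
pose L := expR (\sum_(k < K) normc (c k.+1)).
have cL N : \sum_(n < N) normc (coef_exp c n) <= L.
  apply: le_trans (coef_exp_l1 N c0) _; rewrite ler_expR.
  have [NK|KN] := leqP N K.
    rewrite (big_ord_widen K (fun k => normc (c k.+1))) // big_mkcond /=.
    by apply: ler_sum => i _; case: ifP => // _; exact: normc_ge0.
  rewrite [leRHS](big_ord_widen N (fun k => normc (c k.+1))) 1?ltnW //.
  rewrite [leRHS]big_mkcond; apply: ler_sum => i _; case: ltnP => // Ki.
  by rewrite /c /= XY // subrr normc0.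
exists (L ^+ 2 * M) => N.
apply: le_trans (_ : L ^+ 2 * \sum_(n < N) sobolev_weight s n *
   normc (hmc_coef Y n) ^+ 2 <= _); last by rewrite ler_wpM2l ?sqr_ge0.
apply: le_trans (young_weighted (w := sobolev_weight s)
  (c := fun n => normc (coef_exp c n)) (fun n => normc (hmc_coef Y n)) N
  _ _ _ cL).
- apply: ler_sum => n _; rewrite ler_wpM2l ?sobolev_weight_ge0 //.
  rewrite lerXn2r ?nnegrE ?normc_ge0 //.
    by apply: sumr_ge0 => i _; rewrite mulr_ge0 ?normc_ge0.
  have -> : hmc_coef X n = \sum_(i < n.+1) coef_exp c i * hmc_coef Y (n - i).
    rewrite /hmc_coef -coef_expD //; congr (coef_exp _ n).
    by apply/funext => k; rewrite /c subrK.
  apply: le_trans (normc_sum _ _ _) _.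
  by apply: ler_sum => i _; rewrite normcM.
- exact: sobolev_weight_ge0.
- by move=> m n; apply: sobolev_weight_anti.
- by move=> n; apply: normc_ge0.
Qed.

End Sobolev.

(** * Bounded complex random variables *)

Section BoundedMeasurable.
Context d (T : measurableType d) (R : realType).
Implicit Types f g : T -> R[i].

Definition bdd_meas f := [/\ measurable_fun setT (fun x => complex.Re (f x)),
  measurable_fun setT (fun x => complex.Im (f x)) &
  exists M : R, forall x, normc (f x) <= M].

Lemma ReD (x y : R[i]) : complex.Re (x + y) = complex.Re x + complex.Re y.
Proof. by case: x; case: y. Qed.
Lemma ImD (x y : R[i]) : complex.Im (x + y) = complex.Im x + complex.Im y.
Proof. by case: x; case: y. Qed.
Lemma ReM (x y : R[i]) : complex.Re (x * y) =
  complex.Re x * complex.Re y - complex.Im x * complex.Im y.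
Proof. by case: x; case: y. Qed.
Lemma ImM (x y : R[i]) : complex.Im (x * y) =
  complex.Re x * complex.Im y + complex.Im x * complex.Re y.
Proof. by case: x; case: y. Qed.

Lemma Re_le_normc (x : R[i]) : `|complex.Re x| <= normc x.
Proof. by case: x => a b /=; rewrite -sqrtr_sqr ler_wsqrtr // lerDl sqr_ge0. Qed.

Lemma Im_le_normc (x : R[i]) : `|complex.Im x| <= normc x.
Proof. by case: x => a b /=; rewrite -sqrtr_sqr ler_wsqrtr // lerDr sqr_ge0. Qed.

Lemma normc_le_ReIm (x : R[i]) : normc x <= `|complex.Re x| + `|complex.Im x|.
Proof.
case: x => a b /=; rewrite -[leRHS]ger0_norm ?addr_ge0 // -sqrtr_sqr.
rewrite ler_wsqrtr // sqrrD !real_normK ?num_real //.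
have := mulr_ge0 (normr_ge0 a) (normr_ge0 b); lra.
Qed.

Lemma eq_bdd_meas f g : f =1 g -> bdd_meas f -> bdd_meas g.
Proof. by move=> /funext ->. Qed.

Lemma bdd_meas_cst (c : R[i]) : bdd_meas (fun=> c).
Proof. by split; [exact: measurable_cst|exact: measurable_cst|exists (normc c)]. Qed.

Lemma bdd_measD f g : bdd_meas f -> bdd_meas g -> bdd_meas (fun x => f x + g x).
Proof.
move=> [rf jf [M Mf]] [rg jg [L Lg]]; split.
- by under eq_fun do rewrite ReD; apply: measurable_funD.
- by under eq_fun do rewrite ImD; apply: measurable_funD.
- by exists (M + L) => x; apply: le_trans (le_normcD _ _) (lerD (Mf x) (Lg x)).
Qed.

Lemma bdd_measM f g : bdd_meas f -> bdd_meas g -> bdd_meas (fun x => f x * g x).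
Proof.
move=> [rf jf [M Mf]] [rg jg [L Lg]]; split.
- by under eq_fun do rewrite ReM; apply: measurable_funB; apply: measurable_funM.
- by under eq_fun do rewrite ImM; apply: measurable_funD; apply: measurable_funM.
- by exists (M * L) => x; rewrite normcM ler_pM ?normc_ge0.
Qed.

Lemma bdd_meas_sum I (r : seq I) (p : pred I) (f : I -> T -> R[i]) :
  (forall i, p i -> bdd_meas (f i)) -> bdd_meas (fun x => \sum_(i <- r | p i) f i x).
Proof.
move=> bf; elim: r => [|i r IH].
  by apply: (eq_bdd_meas _ (bdd_meas_cst 0)) => x; rewrite big_nil.
case pi : (p i); last by apply: (eq_bdd_meas _ IH) => x; rewrite big_cons pi.
apply: (eq_bdd_meas _ (bdd_measD (bf _ pi) IH)) => x; rewrite big_cons pi //.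
Qed.

Lemma bdd_meas_prod I (r : seq I) (p : pred I) (f : I -> T -> R[i]) :
  (forall i, p i -> bdd_meas (f i)) -> bdd_meas (fun x => \prod_(i <- r | p i) f i x).
Proof.
move=> bf; elim: r => [|i r IH].
  by apply: (eq_bdd_meas _ (bdd_meas_cst 1)) => x; rewrite big_nil.
case pi : (p i); last by apply: (eq_bdd_meas _ IH) => x; rewrite big_cons pi.
apply: (eq_bdd_meas _ (bdd_measM (bf _ pi) IH)) => x; rewrite big_cons pi //.
Qed.

Lemma bdd_measX f n : bdd_meas f -> bdd_meas (fun x => f x ^+ n).
Proof.
move=> bf; elim: n => [|n IH]; first exact: bdd_meas_cst.
by apply: (eq_bdd_meas _ (bdd_measM bf IH)) => x; rewrite exprS.
Qed.

Lemma bdd_meas_conj f : bdd_meas f -> bdd_meas (fun x => conjc (f x)).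
Proof.
move=> [rf jf [M Mf]]; split.
- by apply: eq_measurable_fun rf => x _; case: (f x).
- have : measurable_fun setT (fun x => - complex.Im (f x)).
    exact: measurable_funN.
  by apply: eq_measurable_fun => x _; case: (f x).
- by exists M => x; apply: le_trans (Mf x); case: (f x) => a b /=; rewrite sqrrN.
Qed.

Lemma bdd_meas_real (u : T -> R) (M : R) : measurable_fun setT u ->
  (forall x, `|u x| <= M) -> bdd_meas (fun x => (u x)%:C%C).
Proof.
move=> mu uM; split; [exact: mu| |].
  have : measurable_fun setT (cst 0 : T -> R) by exact: measurable_cst.
  exact.
by exists M => x; rewrite normc_realE.
Qed.

Lemma bdd_meas_indic (B : set T) : measurable B -> bdd_meas (fun x => (\1_B x)%:C%C).
Proof.
move=> mB; apply: (@bdd_meas_real _ 1); first exact: measurable_indic.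
by move=> x; rewrite indicE ger0_norm ?ler0n // lern1 leq_b1.
Qed.

End BoundedMeasurable.

Lemma bdd_meas_comp d d' (T : measurableType d) (T' : measurableType d') (R : realType)
  (Y : T -> T') (f : T' -> R[i]) : measurable_fun setT Y ->
  bdd_meas f -> bdd_meas (fun x => f (Y x)).
Proof.
move=> mY [rf jf [M Mf]]; split.
- exact: (measurableT_comp rf).
- exact: (measurableT_comp jf).
- by exists M.
Qed.

Section ComplexExpectation.
Context d (T : measurableType d) (R : realType) (P : probability T R).
Implicit Types f g : T -> R[i].

Definition cE f : R[i] :=
  ((\int[P]_x complex.Re (f x)) +i* (\int[P]_x complex.Im (f x)))%C.

Lemma bdd_integrable (u : T -> R) M : measurable_fun setT u ->
  (forall x, `|u x| <= M) -> P.-integrable setT (EFin \o u).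
Proof.
move=> mu uM; apply: measurable_bounded_integrable => //.
  exact: fin_num_fun_lty.
exists M; split; first exact: num_real.
by move=> L ML x _; apply: le_trans (uM x) (ltW ML).
Qed.

Lemma bdd_meas_Re f : bdd_meas f -> P.-integrable setT (EFin \o (fun x => complex.Re (f x))).
Proof.
move=> [rf _ [M Mf]]; apply: (@bdd_integrable _ M) => // x.
exact: le_trans (Re_le_normc _) (Mf x).
Qed.

Lemma bdd_meas_Im f : bdd_meas f -> P.-integrable setT (EFin \o (fun x => complex.Im (f x))).
Proof.
move=> [_ jf [M Mf]]; apply: (@bdd_integrable _ M) => // x.
exact: le_trans (Im_le_normc _) (Mf x).
Qed.

Lemma fine_setT : fine (P [set: T]) = 1.
Proof. by rewrite probability_setT. Qed.

Lemma eq_cE f g : f =1 g -> cE f = cE g.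
Proof. by move=> /funext ->. Qed.

Lemma cE_cst c : cE (fun=> c) = c.
Proof.
by case: c => a b; rewrite /cE /= !Rintegral_cst // fine_setT !mulr1.
Qed.

Lemma cED f g : bdd_meas f -> bdd_meas g ->
  cE (fun x => f x + g x) = cE f + cE g.
Proof.
move=> bf bg; rewrite /cE; under eq_Rintegral do rewrite ReD.
under [X in (_ +i* X)%C]eq_Rintegral do rewrite ImD.
rewrite (RintegralD measurableT (bdd_meas_Re bf) (bdd_meas_Re bg)).
by rewrite (RintegralD measurableT (bdd_meas_Im bf) (bdd_meas_Im bg)).
Qed.

Lemma cEZ c f : bdd_meas f -> cE (fun x => c * f x) = c * cE f.
Proof.
move=> bf; have iR := bdd_meas_Re bf; have iI := bdd_meas_Im bf.
have iZ (a : R) u : P.-integrable setT (EFin \o u) ->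
    P.-integrable setT (EFin \o (fun x => a * u x)).
  by move=> iu; apply: (eq_integrable _ _ _ _ (integrableZl _ a iu)).
rewrite /cE; under eq_Rintegral do rewrite ReM.
under [X in (_ +i* X)%C]eq_Rintegral do rewrite ImM.
rewrite RintegralB ?RintegralD //; try exact: iZ.
by rewrite !RintegralZl //; case: c.
Qed.

Lemma cE_sum I (r : seq I) (p : pred I) (f : I -> T -> R[i]) :
  (forall i, p i -> bdd_meas (f i)) ->
  cE (fun x => \sum_(i <- r | p i) f i x) = \sum_(i <- r | p i) cE (f i).
Proof.
move=> bf; elim: r => [|i r IH].
  by rewrite big_nil -[RHS](cE_cst 0); apply: eq_cE => x; rewrite big_nil.
rewrite big_cons -IH; case: ifP => pi.
  rewrite -cED; [|exact: bf|exact: bdd_meas_sum].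
  by apply: eq_cE => x; rewrite big_cons pi.
by apply: eq_cE => x; rewrite big_cons pi.
Qed.

Lemma cE_conj f : bdd_meas f -> cE (fun x => conjc (f x)) = conjc (cE f).
Proof.
move=> bf; rewrite /cE /=; congr (_ +i* _)%C.
  by apply: eq_Rintegral => x _; case: (f x).
rewrite -[RHS]mulN1r -RintegralZl //; last exact: bdd_meas_Im.
by apply: eq_Rintegral => x _; case: (f x) => a b /=; rewrite mulN1r.
Qed.

Lemma cE_real (u : T -> R) : cE (fun x => (u x)%:C%C) = (\int[P]_x u x)%:C%C.
Proof. by rewrite /cE /= Rintegral_cst // mul0r. Qed.

Lemma cE_indic (B : set T) : measurable B -> cE (fun x => (\1_B x)%:C%C) = (fine (P B))%:C%C.
Proof. by move=> mB; rewrite cE_real /Rintegral integral_indic // setIT. Qed.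

Lemma Rintegral_bound (u : T -> R) M : measurable_fun setT u ->
  (forall x, `|u x| <= M) -> `|\int[P]_x u x| <= M.
Proof.
move=> mu uM; have iu := bdd_integrable mu uM.
apply: le_trans (le_normr_Rintegral _ iu) _ => //.
have -> : M = \int[P]_x M by rewrite Rintegral_cst // fine_setT mulr1.
apply: le_Rintegral => //.
- apply: (@bdd_integrable _ M); first exact: measurableT_comp.
  by move=> x; rewrite normr_id.
- apply: (@bdd_integrable _ `|M|) => //; exact: measurable_cst.
Qed.

Lemma cE_bound f M : bdd_meas f -> (forall x, normc (f x) <= M) ->
  normc (cE f) <= 2 * M.
Proof.
move=> [rf jf _] fM; apply: le_trans (normc_le_ReIm _) _.
rewrite mulr_natl mulr2n; apply: lerD; apply: Rintegral_bound => // x.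
  exact: le_trans (Re_le_normc _) (fM x).
exact: le_trans (Im_le_normc _) (fM x).
Qed.

End ComplexExpectation.

(** * Independence and expectations of products *)

(** The sum counts the integers in [1, y], so the difference is the fractional part
    of y. This approximates a bounded function by indicators. *)
Lemma sum_thresholds (R : realType) (y : R) L : 0 <= y -> y <= L%:R ->
  0 <= y - \sum_(j < L) ((j.+1%:R <= y)%R)%:R <= 1.
Proof.
elim: L => [|L IH] y0 yL; first by rewrite big_ord0; lra.
rewrite big_ord_recr /=; have [yL'|yL'] := leP y L%:R.
  have -> : (L.+1%:R <= y) = false.
    by apply/negbTE; rewrite -ltNge (le_lt_trans yL') // ltr_nat.
  by rewrite addr0 IH.
have -> : \sum_(j < L) ((j.+1%:R <= y)%R)%:R = L%:R :> R.
  rewrite (eq_bigr (fun=> 1)) => [|j _]; first by rewrite sumr_const card_ord.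
  by rewrite (le_trans _ (ltW yL')) // ler_nat.
have e : L.+1%:R = L%:R + 1 :> R by rewrite -natr1.
by case: (leP L.+1%:R y) => h; rewrite ?addr0; move: yL; rewrite e /=; lra.
Qed.

Section Independence.
Context d (T : measurableType d) (R : realType) (P : probability T R).

Section OneVariable.
Variables (Y : {RV P >-> R}) (W : T -> R[i]).
Hypothesis bW : bdd_meas W.

Definition uncorrelated (f : R -> R[i]) :=
  cE P (fun w => f (Y w) * W w) = cE P (fun w => f (Y w)) * cE P W.

Lemma bdd_meas_RV (f : R -> R[i]) : bdd_meas f -> bdd_meas (fun w => f (Y w)).
Proof. by apply: bdd_meas_comp; exact: measurable_funPT. Qed.

Lemma uncorrelatedD f g : bdd_meas f -> bdd_meas g ->
  uncorrelated f -> uncorrelated g -> uncorrelated (fun x => f x + g x).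
Proof.
move=> bf bg uf ug; rewrite /uncorrelated cED ?mulrDl -?uf -?ug; try exact: bdd_meas_RV.
rewrite -cED; try by apply: bdd_measM => //; exact: bdd_meas_RV.
by apply: eq_cE => w; rewrite mulrDl.
Qed.

Lemma uncorrelatedZ c f : bdd_meas f ->
  uncorrelated f -> uncorrelated (fun x => c * f x).
Proof.
move=> bf uf; rewrite /uncorrelated cEZ -?mulrA -?uf; try exact: bdd_meas_RV.
rewrite -cEZ; last by apply: bdd_measM => //; exact: bdd_meas_RV.
by apply: eq_cE => w; rewrite mulrA.
Qed.

Lemma uncorrelated_cst c : uncorrelated (fun=> c).
Proof. by rewrite /uncorrelated cE_cst cEZ. Qed.

Lemma uncorrelated_lim f : bdd_meas f ->
  (forall n, exists g, [/\ bdd_meas g, uncorrelated g &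
     forall x, normc (f x - g x) <= n.+1%:R^-1]) -> uncorrelated f.
Proof.
move=> bf apx; have [_ _ [K' WK']] := bW; pose K := `|K'|.
have WK x : normc (W x) <= K := le_trans (WK' x) (ler_norm _).
pose D := cE P (fun w => f (Y w) * W w) - cE P (fun w => f (Y w)) * cE P W.
pose L := 2 * K + 2 * normc (cE P W).
suff h n : normc D <= L / n.+1%:R.
  apply/eqP; rewrite -subr_eq0; apply/eqP; apply: eq0_normc; apply/eqP.
  rewrite eq_le normc_ge0 andbT leNgt; apply/negP => D0.
  have := h (Num.truncn (L / normc D)); rewrite ler_pdivlMr ?ltr0Sn //.
  rewrite mulrC -ler_pdivlMr // leNgt => /negP; apply.
  exact: truncnS_gt.
have [g [bg ug fg]] := apx n.
have bN : bdd_meas (fun x => -1 * g x) by apply: bdd_measM => //; exact: bdd_meas_cst.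
pose h x := f x + -1 * g x.
have bh : bdd_meas h by exact: bdd_measD.
have hn x : normc (h x) <= n.+1%:R^-1 by rewrite /h mulN1r.
have -> : D = cE P (fun w => h (Y w) * W w) - cE P (fun w => h (Y w)) * cE P W.
  have -> : cE P (fun w => h (Y w)) = cE P (fun w => f (Y w)) - cE P (fun w => g (Y w)).
    rewrite cED ?cEZ ?mulN1r //.
    - exact: bdd_meas_RV bg.
    - exact: bdd_meas_RV bf.
    - exact: bdd_meas_RV bN.
  have -> : cE P (fun w => h (Y w) * W w) =
      cE P (fun w => f (Y w) * W w) - cE P (fun w => g (Y w) * W w).
    have bfW := bdd_measM (bdd_meas_RV bf) bW.
    have bgW := bdd_measM (bdd_meas_RV bg) bW.
    rewrite -[- cE _ _]mulN1r -cEZ // -cED //.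
      by apply: eq_cE => w; rewrite /h; ring.
    by apply: bdd_measM bgW; exact: bdd_meas_cst.
  by rewrite ug /D; ring.
apply: le_trans (le_normcD _ _) _; rewrite normcN normcM /L mulrDl.
apply: lerD.
  rewrite -mulrA; apply: cE_bound => [|w]; first by apply: bdd_measM => //; exact: bdd_meas_RV.
  by rewrite normcM mulrC ler_pM ?normc_ge0.
rewrite mulrAC ler_wpM2r ?normc_ge0 //; apply: cE_bound => //.
exact: bdd_meas_RV.
Qed.

Hypothesis indicW : forall B, measurable B ->
  uncorrelated (fun x => (\1_B x)%:C%C).

(** The function (1/n) #{j >= 1 : j <= n f} is a combination of indicators at
    uniform distance at most 1/n from f. *)
Lemma uncorrelated_nonneg (f : R -> R) (M : nat) : measurable_fun setT f ->
  (forall x, 0 <= f x <= M%:R) -> uncorrelated (fun x => (f x)%:C%C).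
Proof.
move=> mf fM; apply: uncorrelated_lim => [|n].
  by apply: (bdd_meas_real (M := M%:R)) => // x; rewrite ger0_norm; case/andP: (fM x).
pose B (j : nat) := f @^-1` `[j.+1%:R / n.+1%:R, +oo[.
have mB j : measurable (B j) by rewrite -[B j]setTI; apply: mf.
pose g x : R[i] := \sum_(j < M * n.+1) (n.+1%:R^-1)%:C%C * (\1_(B j) x)%:C%C.
have bg j : bdd_meas (fun x => (n.+1%:R^-1)%:C%C * (\1_(B j) x)%:C%C : R[i]).
  by apply: bdd_measM; [exact: bdd_meas_cst|exact: bdd_meas_indic].
exists g; split.
- by apply: bdd_meas_sum => j _; exact: bg.
- rewrite /g; elim: (_ * _)%N => [|L IH].
    rewrite (_ : (fun _ => _) = fun=> 0); last by apply/funext => x; rewrite big_ord0.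
    exact: uncorrelated_cst.
  rewrite (_ : (fun _ => _) = fun x => \sum_(j < L) (n.+1%:R^-1)%:C%C * (\1_(B j) x)%:C%C
     + (n.+1%:R^-1)%:C%C * (\1_(B L) x)%:C%C); last first.
    by apply/funext => x; rewrite big_ord_recr.
  apply: uncorrelatedD => //; first by apply: bdd_meas_sum => j _; exact: bg.
  by apply: uncorrelatedZ; [exact: bdd_meas_indic|exact: indicW].
- move=> x; have n0 : (0 : R) < n.+1%:R by rewrite ltr0Sn.
  have -> : (f x)%:C%C - g x = (n.+1%:R^-1 *
     (f x * n.+1%:R - \sum_(j < M * n.+1) ((j.+1%:R <= f x * n.+1%:R)%R)%:R))%:C%C.
    rewrite mulrBr mulrC mulfK ?gt_eqF // rmorphB; congr (_ - _).
    rewrite /g -mulr_sumr rmorphM rmorph_sum; congr (_ * _); apply: eq_bigr => j _.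
    rewrite indicE; congr ((_%:R)%:C)%C.
    rewrite /B -ler_pdivrMr //; congr nat_of_bool.
    by apply/idP/idP; rewrite inE /= in_itv /= andbT.
  have /andP[f0 fx] := fM x.
  have /andP[h0 h1] := @sum_thresholds R (f x * n.+1%:R) (M * n.+1)
    (mulr_ge0 f0 (ltW n0)) (eq_ind_r (fun z => _ <= z) (ler_wpM2r (ltW n0) fx) (natrM _ _ _)).
  have i0 : 0 <= n.+1%:R^-1 :> R by rewrite invr_ge0 ltW.
  by rewrite normc_realE ger0_norm ?mulr_ge0 // -[leRHS]mulr1 ler_wpM2l.
Qed.

Lemma uncorrelated_bdd_meas f : bdd_meas f -> uncorrelated f.
Proof.
move=> bf; have [rf jf [M fM]] := bf.
pose L := (Num.truncn M).+1.
have ML : M <= L%:R by exact/ltW/truncnS_gt.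
have part (u : R -> R) : measurable_fun setT u -> (forall x, `|u x| <= M) ->
    bdd_meas (fun x => (u x)%:C%C) /\ uncorrelated (fun x => (u x)%:C%C).
  move=> mu uM; split; first exact: (bdd_meas_real (M := M)).
  rewrite (_ : (fun _ => _) = fun x => (u x + L%:R)%:C%C + (- L%:R)%:C%C); last first.
    by apply/funext => x; rewrite -rmorphD /= addrK.
  have mv : measurable_fun setT (fun x => u x + L%:R).
    by apply: measurable_funD => //; exact: measurable_cst.
  have vM x : 0 <= u x + L%:R <= (L + L)%:R.
    by have := uM x; rewrite ler_norml natrD; move: ML; set l := L%:R; lra.
  apply: uncorrelatedD; [|exact: bdd_meas_cst| |exact: uncorrelated_cst].
    by apply: (bdd_meas_real (M := (L + L)%:R)) => // x; rewrite ger0_norm; case/andP: (vM x).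
  exact: uncorrelated_nonneg vM.
have [bR uR] := part _ rf (fun x => le_trans (Re_le_normc _) (fM x)).
have [bI uI] := part _ jf (fun x => le_trans (Im_le_normc _) (fM x)).
rewrite (_ : f = fun x => (complex.Re (f x))%:C%C + 'i%C * (complex.Im (f x))%:C%C).
  apply: uncorrelatedD => //; last exact: uncorrelatedZ.
  by apply: bdd_measM => //; exact: bdd_meas_cst.
by apply/funext => x; rewrite -complexE.
Qed.

End OneVariable.

(** Independence passes from events to bounded functions one index at a time:
    when the rule is known with an indicator at index i, the remaining product is
    uncorrelated with every event of [Y i], hence with every bounded function of
    [Y i]. The induction is on the set of indices at which f is arbitrary. *)
Lemma cE_prod (I : finType) (Y : I -> {RV P >-> R}) (f : I -> R -> R[i]) :
  (forall B : I -> set R, (forall i, measurable (B i)) ->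
    P (\bigcap_i Y i @^-1` B i) = (\prod_i P (Y i @^-1` B i))%E) ->
  (forall i, bdd_meas (f i)) ->
  cE P (fun w => \prod_i f i (Y i w)) = \prod_i cE P (fun w => f i (Y i w)).
Proof.
move=> indY.
suff main (s : seq I) : forall f : I -> R -> R[i], (forall i, bdd_meas (f i)) ->
    (forall i, i \notin s -> exists2 B, measurable B & f i = fun x => (\1_B x)%:C%C) ->
    cE P (fun w => \prod_i f i (Y i w)) = \prod_i cE P (fun w => f i (Y i w)).
  by move=> bf; apply: (main (enum I)) => // i; rewrite mem_enum.
elim: s => [|i s IH] {}f bf fB.
  have /choice[B hB] : forall i, exists B, measurable B /\ f i = fun x => (\1_B x)%:C%C.
    by move=> i; have [//|B mB e] := fB i; exists B.
  have mYB i : measurable (Y i @^-1` B i) by apply: measurable_funPTI; case: (hB i).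
  transitivity (cE P (fun w => (\1_(\bigcap_i Y i @^-1` B i) w)%:C%C)).
    apply: eq_cE => w.
    have -> : \1_(\bigcap_i Y i @^-1` B i) w = \prod_i \1_(Y i @^-1` B i) w :> R.
      have [h|h] := pselect (forall i, B i (Y i w)).
        rewrite indicE mem_set => [|i _]; last exact: h.
        by rewrite big1 // => i _; rewrite indicE mem_set //; exact: h.
      have [i /eqP hi] : exists i, \1_(Y i @^-1` B i) w == 0 :> R.
        apply: contrapT => H; apply: h => i; apply: contrapT => Bi; apply: H.
        by exists i; rewrite indicE memNset.
      rewrite (bigD1 i) //= hi mul0r indicE memNset // => H.
      by move: hi; rewrite indicE mem_set ?oner_eq0 //; [move/eqP; rewrite oner_eq0|exact: H].
    rewrite rmorph_prod; apply: eq_bigr => i _.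
    by rewrite (hB i).2 !indicE; congr ((_%:R)%:C)%C.
  rewrite cE_indic; last by apply: fin_bigcap_measurable.
  rewrite indY; last by move=> i; case: (hB i).
  transitivity (\prod_i (fine (P (Y i @^-1` B i)))%:C%C).
    rewrite -rmorph_prod; congr (_%:C)%C.
    by rewrite (eq_bigr (fun i => (fine (P (Y i @^-1` B i)))%:E)) ?prodEFin // => i _;
       rewrite fineK // fin_num_measure.
  apply: eq_bigr => i _; rewrite -cE_indic //; apply: eq_cE => w.
  by rewrite (hB i).2 !indicE.
pose fg g := fun j => if j == i then g else f j.
pose W w := \prod_(j | j != i) f j (Y j w).
have bW : bdd_meas W by apply: bdd_meas_prod => j _; exact: bdd_meas_RV.
have IHi B : measurable B ->
    cE P (fun w => (\1_B (Y i w))%:C%C * W w) =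
    cE P (fun w => (\1_B (Y i w))%:C%C) * \prod_(j | j != i) cE P (fun w => f j (Y j w)).
  move=> mB; have := IH (fg (fun x => (\1_B x)%:C%C)).
  have -> : cE P (fun w => \prod_j fg (fun x => (\1_B x)%:C%C) j (Y j w)) =
     cE P (fun w => (\1_B (Y i w))%:C%C * W w).
    apply: eq_cE => w; rewrite (bigD1 i) //= /fg eqxx; congr (_ * _).
    by apply: eq_bigr => j /negbTE ->.
  move=> -> => [|j|j js]; rewrite /fg.
  - by rewrite (bigD1 i) //= eqxx; congr (_ * _); apply: eq_bigr => j /negbTE ->.
  - by case: eqP => // _; exact: bdd_meas_indic.
  - by case: eqP => [_|/eqP ji]; [exists B|apply: fB; rewrite inE negb_or ji].
have EW : cE P W = \prod_(j | j != i) cE P (fun w => f j (Y j w)).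
  have := IHi setT measurableT.
  rewrite (_ : (fun w => (\1_setT (Y i w))%:C%C * W w) = W); last first.
    by apply/funext => w; rewrite indicT mul1r.
  move=> ->; rewrite -[RHS]mul1r; congr (_ * _).
  by rewrite -[RHS](cE_cst P); apply: eq_cE => w; rewrite indicT.
transitivity (cE P (fun w => f i (Y i w) * W w)).
  by apply: eq_cE => w; rewrite (bigD1 i).
rewrite (bigD1 i) //= -EW; apply: uncorrelated_bdd_meas => // B mB.
by rewrite /uncorrelated EW; exact: IHi.
Qed.

End Independence.

(** * Uniform angles, and the joint family of angles and radii *)

Section Angles.
Context d (T : measurableType d) (R : realType) (P : probability T R).

Lemma expiX (t : R) n : expi t ^+ n = expi (n%:R * t).
Proof.
elim: n => [|n IH]; first by rewrite mul0r /expi cos0 sin0.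
rewrite exprS IH -natr1 mulrDl mul1r addrC /expi cosD sinD.
by rewrite [LHS]/GRing.mul /=; congr (_ +i* _)%C; rewrite addrC.
Qed.

Lemma conjc_expiM (t : R) : conjc (expi t) * expi t = 1.
Proof.
rewrite [LHS]/GRing.mul /=; congr (_ +i* _)%C.
  by rewrite mulNr opprK -!expr2 cos2Dsin2.
by rewrite mulNr mulrC subrr.
Qed.

Lemma bdd_meas_expi : bdd_meas (@expi R).
Proof.
split; [| |exists 1 => x].
- by apply: continuous_measurable_fun; exact: continuous_cos.
- by apply: continuous_measurable_fun; exact: continuous_sin.
- by rewrite /= cos2Dsin2 sqrtr1.
Qed.

(** The law on the interval gives the mean of g as the increment of its primitive
    divided by 2 pi. The function 1 + g is integrated instead of g so that the
    integrals are those of nonnegative functions. *)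
Lemma uniform_angle_mean0 (Y : {RV P >-> R}) (g G : R -> R) :
  uniform_angle Y -> continuous g -> (forall x, `|g x| <= 1) ->
  (forall x : R, is_derive x (1 : R) G (g x)) -> G pi = G (- pi) ->
  \int[P]_w g (Y w) = 0.
Proof.
move=> uY cg g1 dG Gpi.
have mg : measurable_fun setT g by exact: continuous_measurable_fun.
have mg1 : measurable_fun setT (fun x => 1 + g x).
  by apply: measurable_funD => //; exact: measurable_cst.
have pos x : 0 <= 1 + g x by have := g1 x; rewrite ler_norml; lra.
have mY : measurable_fun setT Y by exact: measurable_funPT.
have pi0 : 0 < pi :> R := pi_gt0 R.
have E1 : (\int[P]_w (1 + g (Y w))%:E = 1)%E.
  (* [uniform_prob] is a measure on [measurableTypeR R], whose display differs
     from the default one on R: Y is repackaged with that codomain. *)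
  have mY' : measurable_fun setT (Y : T -> measurableTypeR R) by exact: mY.
  pose Y' : {RV P >-> measurableTypeR R} :=
    HB.pack (Y : T -> measurableTypeR R) (isMeasurableFun.Build _ _ _ _ _ mY').
  have mh : measurable_fun setT (fun x : measurableTypeR R => (1 + g x)%:E).
    by apply/measurable_EFinP; exact: mg1.
  transitivity (\int[distribution P Y']_x (1 + g x)%:E)%E.
    by rewrite (@ge0_integral_distribution _ _ _ _ _ P Y' (fun x => (1 + g x)%:E)).
  rewrite (eq_measure_integral (uniform_prob (ltNpipi R))); last first.
    by move=> A mA _; exact: uY.
  rewrite integral_uniform //.
  have dF x : is_derive x (1 : R) (fun y => y + G y) (1 + g x).
    exact: is_deriveD.
  have cF x : {for x, continuous (fun y => y + G y)}.
    apply: differentiable_continuous; apply/derivable1_diffP.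
    by apply: ex_derive.
  rewrite (@continuous_FTC2 _ _ (fun y => y + G y)).
  - rewrite -EFinB -EFinM Gpi; congr (_%:E).
    have -> : pi + G (- pi) - (- pi + G (- pi)) = pi - - pi :> R by ring.
    by rewrite mulVf // gt_eqF // subr_gt0 ltNpipi.
  - exact: ltNpipi.
  - apply: continuous_subspaceT => x; apply: cvgD; [exact: cvg_cst|exact: cg].
  - split.
    + by move=> x _; apply: ex_derive.
    + by apply: cvg_at_right_filter; exact: cF.
    + by apply: cvg_at_left_filter; exact: cF.
  - by move=> x _; rewrite derive1E; apply: derive_val.
have ig : P.-integrable setT (EFin \o (fun w => g (Y w))).
  by apply: (bdd_integrable P (M := 1)) => //; exact: (measurableT_comp mg).
have i1 : P.-integrable setT (EFin \o (fun w => 1 : R)).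
  by apply: (bdd_integrable P (M := 1)) => [|x]; [exact: measurable_cst|rewrite normr1].
have := RintegralD measurableT i1 ig.
rewrite Rintegral_cst // fine_setT mul1r {1}/Rintegral E1 /= => h.
by apply: (@addrI _ 1); rewrite addr0 -h.
Qed.

Lemma cE_expi (Y : {RV P >-> R}) n : uniform_angle Y -> (0 < n)%N ->
  cE P (fun w => expi (Y w) ^+ n) = 0.
Proof.
move=> uY n0; have nR : (n%:R : R) != 0 by rewrite pnatr_eq0 -lt0n.
have dn (x : R) : is_derive x (1 : R) (fun y : R => n%:R * y) n%:R.
  by apply: is_derive_eq; rewrite scaler1.
have cn : continuous (fun y : R => n%:R * y) by exact: mulrl_continuous.
rewrite (@eq_cE _ _ _ _ _ (fun w => expi (n%:R * Y w))) => [|w]; last exact: expiX.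
have spi : sin (n%:R * pi : R) = 0.
  elim: {+}n => [|k IH]; first by rewrite mul0r sin0.
  by rewrite -natr1 mulrDl mul1r sinDpi IH oppr0.
rewrite /cE /=; congr (_ +i* _)%C.
- apply: (uniform_angle_mean0 (g := fun x => cos (n%:R * x))
    (G := fun x => n%:R^-1 * sin (n%:R * x)) uY).
  + by move=> x; apply: continuous_comp; [exact: cn|exact: continuous_cos].
  + by move=> x; rewrite ler_norml cos_geN1 cos_le1.
  + move=> x; apply: is_derive_eq.
    by rewrite /GRing.scale /= mulrCA mulVf // mulr1.
  + by rewrite mulrN sinN spi oppr0.
- apply: (uniform_angle_mean0 (g := fun x => sin (n%:R * x))
    (G := fun x => - n%:R^-1 * cos (n%:R * x)) uY).
  + by move=> x; apply: continuous_comp; [exact: cn|exact: continuous_sin].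
  + by move=> x; rewrite ler_norml sin_geN1 sin_le1.
  + move=> x; apply: is_derive_eq.
    by rewrite /GRing.scale /= mulNr mulNr mulrN opprK mulrCA mulVf // mulr1.
  + by rewrite mulrN cosN.
Qed.

Lemma conjc_monomial (z : R[i]) m n :
  conjc (z ^+ n * conjc z ^+ m) = z ^+ m * conjc z ^+ n.
Proof. by rewrite rmorphM !rmorphXn /= conjcK mulrC. Qed.

Lemma cE_expi_orthogonal (Y : {RV P >-> R}) m n : uniform_angle Y ->
  cE P (fun w => expi (Y w) ^+ m * conjc (expi (Y w)) ^+ n) = (m == n)%:R.
Proof.
move=> uY.
wlog mn : m n / (n <= m)%N => [wl|].
  have [/wl//|nm] := leqP n m.
  have := wl n m (ltnW nm) => /(congr1 (@conjc R)).
  rewrite -cE_conj.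
    rewrite eq_sym conjc_nat => <-; apply: eq_cE => w.
    by rewrite -conjc_monomial.
  apply: bdd_measM; apply: bdd_measX; last apply: bdd_meas_conj.
    exact: bdd_meas_RV bdd_meas_expi.
  exact: bdd_meas_RV bdd_meas_expi.
rewrite (@eq_cE _ _ _ _ _ (fun w => expi (Y w) ^+ (m - n))) => [|w]; last first.
  rewrite -{1}(subnK mn) exprD -mulrA -exprMn [_ * conjc _]mulrC.
  by rewrite conjc_expiM expr1n mulr1.
case: eqP => [->|/eqP ne]; first by rewrite subnn cE_cst.
by rewrite cE_expi // subn_gt0 ltn_neqAle eq_sym ne.
Qed.

End Angles.

Section Joint.
Context d (T : measurableType d) (R : realType) (P : probability T R).
Variables (tau Rad : nat -> {RV P >-> R}).
Hypotheses (itau : mutually_independent tau) (iRad : mutually_independent Rad)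
  (irt : independent_families Rad tau).

(** The angles and the radii as one finite family, to which [cE_prod] applies. *)
Definition joint N (i : 'I_N + 'I_N) : {RV P >-> R} :=
  match i with inl k => tau k | inr k => Rad k end.

Lemma sigma_family_bigcap (Y : nat -> {RV P >-> R}) (J : seq nat) (B : nat -> set R) :
  (forall k, measurable (B k)) ->
  sigma_family Y (\bigcap_(k in [set` J]) Y k @^-1` B k).
Proof.
move=> mB; rewrite /sigma_family.
apply: (@fin_bigcap_measurable _ (g_sigma_algebraType _)); first exact: finite_seq.
move=> k _; apply: sub_sigma_algebra; exists k => //=.
by exists (B k) => //; rewrite setTI.
Qed.

Lemma jointP N (B : 'I_N + 'I_N -> set R) : (forall i, measurable (B i)) ->
  P (\bigcap_i joint i @^-1` B i) = (\prod_i P (joint i @^-1` B i))%E.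
Proof.
move=> mB.
pose ext (b : 'I_N -> set R) (k : nat) := if insub k is Some i then b i else setT.
have extE b (i : 'I_N) : ext b i = b i by rewrite /ext valK.
have mext b : (forall i, measurable (b i)) -> forall k, measurable (ext b k).
  by move=> mb k; rewrite /ext; case: insubP.
pose Bt := ext (fun k => B (inl k)); pose Br := ext (fun k => B (inr k)).
have mBt : forall k, measurable (Bt k) by apply: mext.
have mBr : forall k, measurable (Br k) by apply: mext.
have -> : \bigcap_i joint i @^-1` B i =
    (\bigcap_(k in [set` iota 0 N]) Rad k @^-1` Br k) `&`
    (\bigcap_(k in [set` iota 0 N]) tau k @^-1` Bt k).
  apply/seteqP; split=> w /= h.
    split=> k /=; rewrite mem_iota add0n => kN.
      by have := h (inr (Ordinal kN)) I; rewrite /Br (extE _ (Ordinal kN)).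
    by have := h (inl (Ordinal kN)) I; rewrite /Bt (extE _ (Ordinal kN)).
  have [hr ht] := h.
  case=> k _ /=.
    by have := ht k; rewrite /= mem_iota add0n ltn_ord /Bt extE; apply.
  by have := hr k; rewrite /= mem_iota add0n ltn_ord /Br extE; apply.
rewrite irt; try exact: sigma_family_bigcap.
rewrite itau ?iRad ?iota_uniq // muleC big_sumType /=.
have iotaE (F : nat -> \bar R) : (\prod_(k <- iota 0 N) F k = \prod_(k < N) F k)%E.
  by rewrite -(big_mkord xpredT F) /index_iota subn0.
rewrite !iotaE; congr (_ * _)%E; apply: eq_bigr => k _.
  by rewrite /Bt extE.
by rewrite /Br extE.
Qed.

End Joint.

(** * Second moments of the coefficients *)

Lemma sqr_normcE (R : realType) (z : R[i]) : (normc z ^+ 2)%:C%C = z * conjc z.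
Proof.
case: z => a b; rewrite [RHS]/GRing.mul /= sqr_sqrtr ?addr_ge0 ?sqr_ge0 //.
by congr (_ +i* _)%C; ring.
Qed.

(** This separates the angle from the radius in a product of two powers of the
    same coefficient. *)
Lemma monomial_conj (R : realType) (e : R[i]) (x : R) m m' a b :
  (e * x%:C%C) ^+ m / a%:R * conjc ((e * x%:C%C) ^+ m' / b%:R) =
  (e ^+ m * conjc e ^+ m') * (x%:C%C ^+ (m + m') / (a%:R * b%:R)).
Proof.
rewrite rmorphM fmorphV rmorph_nat rmorphXn rmorphM /= oppr0.
by rewrite !exprMn exprD invfM; ring.
Qed.

Section SecondMoment.
Context d (T : measurableType d) (R : realType) (P : probability T R).
Variables (tau Rad : nat -> {RV P >-> R}).
Hypotheses (itau : mutually_independent tau) (iRad : mutually_independent Rad)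
  (irt : independent_families Rad tau) (utau : forall k, uniform_angle (tau k)).
Variable t : nat -> R -> R.
Hypotheses (mt : forall k, measurable_fun setT (t k)) (t1 : forall k x, `|t k x| <= 1).

(** The sequence of exponents e^{i tau_k} t_k(R_k) attached to bounded functions
    t_k of the radii; index 0 is the absent constant term. *)
Definition rotated (w : T) (k : nat) : R[i] :=
  if k is m.+1 then expi (tau m w) * (t m (Rad m w))%:C%C else 0.

Definition moment k j : R := \int[P]_w t k (Rad k w) ^+ (2 * j).

Lemma bdd_meas_coef_exp n : bdd_meas (fun w => coef_exp (rotated w) n).
Proof.
have e w := @coef_exp_weight R n (rotated w) n erefl (leqnn n).
apply: (eq_bdd_meas (fun w => esym (e w))).
apply: bdd_meas_sum => m _; apply: bdd_meas_prod => k _.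
apply: bdd_measM; last exact: bdd_meas_cst.
apply: bdd_measX; apply: bdd_measM; first exact: bdd_meas_RV (bdd_meas_expi R).
apply: (@bdd_meas_RV _ _ _ P (Rad k) (fun x => (t k x)%:C%C)).
exact: bdd_meas_real (mt k) (t1 k).
Qed.

(** If m and m' differ at k, then the factor E[e^{i (m_k - m'_k) tau_k}]
    vanishes. *)
Lemma cE_monomials N (m m' : {ffun 'I_N -> 'I_N.+1}) :
  cE P (fun w => (\prod_(k < N) (rotated w k.+1 ^+ m k / (m k)`!%:R)) *
        conjc (\prod_(k < N) (rotated w k.+1 ^+ m' k / (m' k)`!%:R))) =
  if m == m' then (\prod_(k < N) (moment k (m k) / (m k)`!%:R ^+ 2))%:C%C else 0.
Proof.
pose f (i : 'I_N + 'I_N) (x : R) : R[i] := match i with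
  | inl k => expi x ^+ m k * conjc (expi x) ^+ m' k
  | inr k => (t k x)%:C%C ^+ (m k + m' k) / ((m k)`!%:R * (m' k)`!%:R) end.
have bf i : bdd_meas (f i).
  case: i => k /=; have be := @bdd_meas_expi R.
    by apply: bdd_measM; apply: bdd_measX => //; apply: bdd_meas_conj.
  apply: bdd_measM; last exact: bdd_meas_cst.
  by apply: bdd_measX; exact: bdd_meas_real (mt k) (t1 k).
rewrite (@eq_cE _ _ _ _ _ (fun w => \prod_i f i (joint tau Rad i w))); last first.
  move=> w; rewrite rmorph_prod -big_split big_sumType /= -big_split.
  apply: eq_bigr => k _ /=.
  exact: monomial_conj.
rewrite cE_prod //; last exact: jointP.
rewrite big_sumType /=.
under eq_bigr => k _ do rewrite cE_expi_orthogonal //.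
case: eqP => [->|/eqP mm']; last first.
  have [k hk] : exists k, m k != m' k.
    apply/existsP; apply: contraNT mm'; rewrite negb_exists => /forallP h.
    by apply/eqP/ffunP => k; have := h k; rewrite negbK => /eqP.
  by rewrite (bigD1 k) //= (negbTE hk : (_ == _ :> nat) = false) !mul0r.
rewrite big1 ?mul1r => [|k _]; last by rewrite eqxx.
rewrite rmorph_prod; apply: eq_bigr => k _.
rewrite (@eq_cE _ _ _ _ _ (fun w =>
    ((m' k)`!%:R * (m' k)`!%:R)^-1 * (t k (Rad k w) ^+ (2 * m' k))%:C%C)).
  rewrite cEZ; last first.
    apply: (@bdd_meas_RV _ _ _ P (Rad k) (fun x => (t k x ^+ (2 * m' k))%:C%C)).
    apply: (eq_bdd_meas _ (bdd_measX (2 * m' k) (bdd_meas_real (mt k) (t1 k)))).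
    by move=> x; rewrite -rmorphXn.
  by rewrite cE_real rmorphM fmorphV rmorphXn rmorph_nat /= mulrC -expr2.
by move=> w; rewrite mulrC -rmorphXn mul2n addnn.
Qed.

Lemma second_moment N n : (n <= N)%N ->
  \int[P]_w (normc (coef_exp (rotated w) n) ^+ 2) =
  \sum_(m : {ffun 'I_N -> 'I_N.+1} | weight m == n)
     \prod_(k < N) (moment k (m k) / (m k)`!%:R ^+ 2).
Proof.
move=> nN; apply: (@complexI R); rewrite -cE_real.
pose u w (m : {ffun 'I_N -> 'I_N.+1}) := \prod_(k < N) (rotated w k.+1 ^+ m k / (m k)`!%:R).
have bu m : bdd_meas (fun w => u w m).
  apply: bdd_meas_prod => k _.
  apply: bdd_measM; last exact: bdd_meas_cst.
  apply: bdd_measX; apply: bdd_measM; first exact: bdd_meas_RV (bdd_meas_expi R).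
  apply: (@bdd_meas_RV _ _ _ P (Rad k) (fun x => (t k x)%:C%C)).
  exact: bdd_meas_real (mt k) (t1 k).
rewrite (@eq_cE _ _ _ _ _ (fun w => \sum_(m | weight m == n) \sum_(m' | weight m' == n)
    u w m * conjc (u w m'))); last first.
  by move=> w; rewrite sqr_normcE (@coef_exp_weight _ N) // rmorph_sum big_distrlr.
have bmm m m' : bdd_meas (fun w => u w m * conjc (u w m')).
  by apply: bdd_measM => //; exact: bdd_meas_conj.
rewrite cE_sum => [|m _]; last by apply: bdd_meas_sum => m' _.
rewrite rmorph_sum; apply: eq_bigr => m hm.
rewrite cE_sum => [|m' _] //.
rewrite (bigD1 m) //= cE_monomials eqxx [X in _ + X]big1 ?addr0 // => m' /andP[_ mm'].
by rewrite cE_monomials eq_sym (negbTE mm').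
Qed.

Lemma moment_ge0 k j : 0 <= moment k j.
Proof. by apply: Rintegral_ge0 => w _; rewrite exprM exprn_ge0 // sqr_ge0. Qed.

Lemma moment_le k j : moment k j.+2 <= moment k 2.
Proof.
have i j' : P.-integrable setT (EFin \o (fun w => t k (Rad k w) ^+ (2 * j'))).
  apply: (bdd_integrable P (M := 1)) => [|x].
    apply: measurable_funX; apply: (measurableT_comp (mt k)).
    exact: measurable_funPT.
  by rewrite normrX exprn_ile1.
apply: le_Rintegral => // x _; rewrite !exprM.
apply: ler_wiXn2l => //; first exact: sqr_ge0.
by rewrite -real_normK ?num_real // exprn_ile1.
Qed.

(** The terms with j >= 2 are at most E|a|^4 / j!, because |a| <= 1; together they
    are at most e E|a|^4. *)
Lemma moment_sum k N :
  \sum_(j < N) moment k j / j`!%:R ^+ 2 <=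
  (1 + moment k 1) * expR (expR 1 * moment k 2).
Proof.
have m0 : moment k 0 = 1 by rewrite /moment Rintegral_cst // fine_setT mulr1.
have h2 : \sum_(j < N) moment k j / j`!%:R ^+ 2 <=
    1 + moment k 1 + expR 1 * moment k 2.
  apply: (@le_trans _ _ (\sum_(j < N.+2) moment k j / j`!%:R ^+ 2)).
    rewrite !big_ord_recr /= -addrA lerDl.
    by rewrite addr_ge0 // divr_ge0 ?moment_ge0 ?sqr_ge0.
  rewrite !big_ord_recl /= m0 !fact0 expr1n !divr1 addrA lerD2l.
  apply: (@le_trans _ _ (\sum_(j < N) moment k 2 * (1 ^+ j.+2 / j.+2`!%:R))).
    apply: ler_sum => j _; rewrite expr1n mul1r ler_pM ?moment_ge0 ?moment_le ?invr_ge0 ?sqr_ge0 //.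
    have f1 : 1 <= j.+2`!%:R :> R by rewrite ler1n fact_gt0.
    rewrite lef_pV2 ?posrE ?exprn_gt0 ?(lt_le_trans ltr01 f1) //.
    by rewrite expr2 ler_peMl // (le_trans ler01).
  rewrite -mulr_sumr mulrC ler_wpM2r ?moment_ge0 //.
  apply: le_trans (exp_partial_le N.+2 ler01).
  rewrite [leRHS]big_ord_recl [leRHS]addrC big_ord_recl [X in _ <= X + _]addrC -addrA lerDl.
  by rewrite addr_ge0 // divr_ge0 // exprn_ge0.
apply: le_trans h2 _.
have := expR_ge1Dx (expR 1 * moment k 2).
have := moment_ge0 k 1; have := moment_ge0 k 2; have := expR_ge0 (1 : R).
move: (moment k 1) (moment k 2) (expR 1) => a b e e0 b0 a0.
move: (expR (e * b)) => E hE.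
apply: le_trans (_ : (1 + a) * (1 + e * b) <= _); last by rewrite ler_wpM2l // addr_ge0.
have : 0 <= a * (e * b) by rewrite !mulr_ge0.
lra.
Qed.

(** Summing over n removes the constraint on the weight and the sum becomes a
    product over k; the factors 1 + 1/(k+1) telescope. *)
Lemma second_moment_sum N :
  (forall k, moment k 1 <= k.+1%:R^-1) ->
  \sum_(n < N.+1) \int[P]_w (normc (coef_exp (rotated w) n) ^+ 2) <=
  expR (expR 1 * \sum_(k < N) moment k 2) * N.+1%:R.
Proof.
move=> h1.
under eq_bigr => n _ do rewrite (@second_moment N) ?leq_ord //.
apply: (@le_trans _ _ (\sum_(m : {ffun 'I_N -> 'I_N.+1})
    \prod_(k < N) (moment k (m k) / (m k)`!%:R ^+ 2))).
  apply: sum_by_weight => m; apply: prodr_ge0 => k _.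
  by rewrite divr_ge0 ?moment_ge0 ?sqr_ge0.
rewrite -(bigA_distr_bigA (fun (k : 'I_N) (j : 'I_N.+1) => moment k j / j`!%:R ^+ 2)).
apply: (@le_trans _ _ (\prod_(k < N) ((1 + k.+1%:R^-1) * expR (expR 1 * moment k 2)))).
  apply: ler_prod => k _; apply/andP; split.
    by apply: sumr_ge0 => j _; rewrite divr_ge0 ?moment_ge0 ?sqr_ge0.
  apply: le_trans (moment_sum _ _) _.
  by rewrite ler_wpM2r ?expR_ge0 // lerD2l.
rewrite big_split /= -expR_sum -mulr_sumr mulrC ler_wpM2l ?expR_ge0 //.
elim: N => [|N IH]; first by rewrite big_ord0.
rewrite big_ord_recr /=.
apply: le_trans (ler_wpM2r _ IH) _; first by rewrite addr_ge0 // invr_ge0.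
by rewrite mulrDr mulr1 mulfV ?pnatr_eq0 // natr1.
Qed.

End SecondMoment.

(** * Deterministic series estimates *)

Section Dyadic.
Variable R : realType.

Lemma sobolev_weight_dyadic (s : R) J n : s <= 0 -> (2 ^ J <= n)%N ->
  sobolev_weight s n <= (4 `^ s) ^+ J.
Proof.
move=> s0 Jn; have -> : (4 `^ s) ^+ J = (4 ^+ J) `^ s :> R.
  by rewrite -powR_mulrn ?powR_ge0 // powRAC powR_mulrn.
rewrite /sobolev_weight -[s]opprK !(powRN _ (- s)).
have p k : 0 < (1 + k%:R ^+ 2 : R) by rewrite ltr_pwDl ?ltr01 ?sqr_ge0.
have p4 : 0 < 4 ^+ J :> R by rewrite exprn_gt0.
rewrite lef_pV2 ?posrE ?powR_gt0 //; apply: ge0_ler_powR.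
- by rewrite oppr_ge0.
- by rewrite nnegrE ltW.
- by rewrite nnegrE ltW.
have -> : 4 ^+ J = (2 ^ J)%:R ^+ 2 :> R.
  by rewrite natrX -exprM mulnC exprM; congr (_ ^+ _); ring.
by rewrite ler_wpDl // lerXn2r ?nnegrE ?ler_nat.
Qed.

(** On the dyadic block 2^J <= n < 2^(J+1) the weight is at most (4^s)^J and v
    sums to at most C 2^(J+1), so the blocks are dominated by a geometric series
    of ratio 2 * 4^s < 1. *)
Lemma linear_growth_summable (s C : R) (v : nat -> R) : s < - 2^-1 ->
  (forall n, 0 <= v n) -> (forall N, \sum_(n < N.+1) v n <= C * N.+1%:R) ->
  exists M, forall N, \sum_(n < N) sobolev_weight s n * v n <= M.
Proof.
move=> sh v0 vC; have s0 : s <= 0 by apply: ltW; lra.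
have C0 : 0 <= C.
  by have := vC 0%N; rewrite big_ord1 mulr1; apply: le_trans.
pose rho : R := 2 * 4 `^ s.
have rho0 : 0 <= rho by rewrite mulr_ge0 // powR_ge0.
have rho1 : rho < 1.
  have e : 2 = 4 `^ 2^-1 :> R.
    rewrite powR12_sqrt // (_ : 4 = 2 ^+ 2); last by ring.
    by rewrite sqrtr_sqr ger0_norm.
  rewrite /rho {1}e -powRD; last by rewrite pnatr_eq0 implybT.
  rewrite /powR (negbTE (_ : 4 != 0)) ?pnatr_eq0 // expR_lt1.
  rewrite pmulr_llt0 ?ln_gt0 ?ltr1n //; lra.
have geo J : \sum_(j < J) rho ^+ j <= (1 - rho)^-1.
  rewrite -[leRHS]mul1r ler_pdivlMr ?subr_gt0 // mulrC.
  by rewrite -opprB mulNr -subrX1 opprB gerBl exprn_ge0.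
have dy J : \sum_(n < 2 ^ J) sobolev_weight s n * v n <=
    C + 2 * C * \sum_(j < J) rho ^+ j.
  elim: J => [|J IH].
    rewrite big_ord1 big_ord0 mulr0 addr0 /sobolev_weight expr0n /= addr0 powR1 mul1r.
    by have := vC 0%N; rewrite big_ord1 mulr1.
  rewrite -(big_mkord xpredT (fun n => sobolev_weight s n * v n)).
  rewrite (big_cat_nat (n := (2 ^ J)%N)) ?leq_pexp2l //= big_mkord.
  rewrite big_ord_recr /= mulrDr addrA; apply: lerD => //.
  apply: (@le_trans _ _ ((4 `^ s) ^+ J * \sum_(0 <= n < 2 ^ J.+1) v n)).
    rewrite mulr_sumr [leRHS](big_cat_nat (n := (2 ^ J)%N)) ?leq_pexp2l //=.
    apply: ler_wpDl.
      by apply: sumr_ge0 => n _; rewrite mulr_ge0 // exprn_ge0 // powR_ge0.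
    rewrite !big_seq; apply: ler_sum => n; rewrite mem_index_iota => /andP[h _].
    by rewrite ler_wpM2r // sobolev_weight_dyadic.
  have vJ : \sum_(n < 2 ^ J.+1) v n <= C * (2 ^ J.+1)%:R.
    by have : (0 < 2 ^ J.+1)%N by [rewrite expn_gt0]; case: (2 ^ J.+1)%N => // K _; exact: vC.
  rewrite big_mkord; apply: le_trans (ler_wpM2l _ vJ) _.
    by rewrite exprn_ge0 // powR_ge0.
  by rewrite /rho exprMn expnS natrM natrX; lra.
exists (C + 2 * C * (1 - rho)^-1) => N.
apply: le_trans (_ : \sum_(n < 2 ^ N) sobolev_weight s n * v n <= _).
  rewrite (big_ord_widen (2 ^ N) (fun n => sobolev_weight s n * v n)) ?(ltnW (ltn_expl _ _)) //.
  rewrite big_mkcond; apply: ler_sum => n _; case: ifP => // _.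
  by rewrite mulr_ge0 // sobolev_weight_ge0.
by apply: le_trans (dy N) _; rewrite lerD2l ler_wpM2l // mulr_ge0.
Qed.

Lemma sum_indic_lt_le (u : R) N : 0 <= u -> \sum_(k < N) ((k.+1%:R < u)%R)%:R <= u.
Proof.
move=> u0; elim: N => [|N IH]; first by rewrite big_ord0.
rewrite big_ord_recr /=; case: ltP => h; last by rewrite addr0.
apply: le_trans (ltW h); rewrite -natr1 lerD2r.
apply: (@le_trans _ _ (\sum_(k < N) 1)); last by rewrite sumr_const card_ord.
by apply: ler_sum => k _; rewrite lern1 leq_b1.
Qed.

(** From 1/k^2 <= 2/k - 2/(k+1). The maximum accounts for the fact that the
    telescoping starts only once k passes u. *)
Lemma sum_inv_sqr_le (u : R) N : 0 < u ->
  \sum_(k < N) ((u <= k.+1%:R)%R)%:R / k.+1%:R ^+ 2 <= 2 / u - 2 / Num.max u N.+1%:R.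
Proof.
move=> u0; elim: N => [|N IH].
  by rewrite big_ord0 subr_ge0 ler_pM2l // lef_pV2 ?posrE ?lt_max ?u0 // le_max lexx.
rewrite big_ord_recr /=; apply: le_trans (lerD IH (lexx _)) _.
have N0 : 0 < N.+1%:R :> R by rewrite ltr0Sn.
have eN : N.+2%:R = N.+1%:R + 1 :> R by rewrite -natr1.
case: (leP u N.+1%:R) => h; last first.
  rewrite mul0r addr0 lerD2l lerN2 ler_pM2l // lef_pV2 ?posrE ?lt_max ?u0 ?orbT //.
  by rewrite le_max lexx.
rewrite mul1r max_r; last by rewrite eN ler_wpDr.
rewrite -addrA lerD2l eN.
have : 1 <= N.+1%:R :> R by rewrite ler1n.
move: N0; move: (N.+1%:R : R) => x x0 x1.
rewrite -subr_ge0 (_ : _ - _ = (x - 1) / (x ^+ 2 * (x + 1))).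
  by apply: divr_ge0; rewrite ?subr_ge0 // mulr_ge0 ?sqr_ge0 // addr_ge0 // ltW.
by field; rewrite !gt_eqF ?addr_gt0.
Qed.

End Dyadic.

(** * Cutoff and almost sure conclusions *)

Section AlmostSure.
Context d (T : measurableType d) (R : realType) (P : probability T R).

Lemma Rintegral_sum (u : nat -> T -> R) N :
  (forall n, P.-integrable setT (EFin \o u n)) ->
  P.-integrable setT (EFin \o (fun w => \sum_(n < N) u n w)) /\
  \int[P]_w (\sum_(n < N) u n w) = \sum_(n < N) \int[P]_w u n w.
Proof.
move=> iu; elim: N => [|N [iN IH]].
  rewrite (_ : (fun w => _) = fun=> 0); last by apply/funext => w; rewrite big_ord0.
  split; last by rewrite Rintegral_cst // mul0r big_ord0.
  by apply: (bdd_integrable P (M := 0)) => [|w]; [exact: measurable_cst|rewrite normr0].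
rewrite (_ : (fun w => _) = fun w => \sum_(n < N) u n w + u N w); last first.
  by apply/funext => w; rewrite big_ord_recr.
split; last by rewrite RintegralD // IH big_ord_recr.
by apply: (eq_integrable _ _ _ _ (integrableD _ iN (iu N))).
Qed.

Lemma ae_bounded_sums (u : nat -> T -> R) :
  (forall n w, 0 <= u n w) ->
  (forall n, P.-integrable setT (EFin \o u n)) ->
  (exists M, forall N, \sum_(n < N) \int[P]_w u n w <= M) ->
  {ae P, forall w, exists M, forall N, \sum_(n < N) u n w <= M}.
Proof.
move=> u0 iu hM.
have mu n : measurable_fun setT (fun w => (u n w)%:E) by have := measurable_int _ (iu n).
have E : (\int[P]_w (\sum_(0 <= n <oo) (u n w)%:E) < +oo)%E.
  rewrite integral_nneseries //; last by move=> n w _; rewrite lee_fin.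
  rewrite (@eq_eseriesr _ _ (fun n => (\int[P]_w u n w)%:E)) => [|n _].
    by apply/nneseries_bounded => // n; apply: Rintegral_ge0.
  by rewrite /Rintegral fineK //; exact: integrable_fin_num (iu n).
have s0 w : (0 <= \sum_(0 <= n <oo) (u n w)%:E)%E.
  by apply: nneseries_ge0 => n _ _; rewrite lee_fin.
have iF : P.-integrable setT (fun w => \sum_(0 <= n <oo) (u n w)%:E)%E.
  apply/integrableP; split.
    by apply: ge0_emeasurable_sum => // n w _ _; rewrite lee_fin.
  by under eq_integral => w _ do rewrite gee0_abs //.
apply: filterS (integrable_ae measurableT iF) => w /(_ I) fw.
apply/(nneseries_bounded (fun n => u0 n w)).
by rewrite -ge0_fin_numE.
Qed.

End AlmostSure.

Section Cutoff.
Variable R : realType.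

Definition small_set (k : nat) : set R := [set x | x ^+ 2 <= k.+1%:R].

Definition cutoff k (x : R) : R := x * \1_(small_set k) x.

Definition scaled_cutoff k (x : R) : R := cutoff k x / Num.sqrt k.+1%:R.

Lemma measurable_small_set k : measurable (small_set k).
Proof.
rewrite (_ : small_set k = (fun x => x ^+ 2) @^-1` `]-oo, k.+1%:R]).
  rewrite -[_ @^-1` _]setTI; have : measurable_fun setT (fun x : R => x ^+ 2) by [].
  by apply.
by apply/seteqP; split=> x; rewrite /= in_itv.
Qed.

Lemma measurable_scaled_cutoff k : measurable_fun setT (scaled_cutoff k).
Proof.
apply: measurable_funM; last exact: measurable_cst.
apply: measurable_funM; first exact: measurable_id.
apply: measurable_indic; exact: measurable_small_set.
Qed.

Lemma cutoffE k x : cutoff k x = if x ^+ 2 <= k.+1%:R then x else 0.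
Proof.
rewrite /cutoff indicE; case: ifP => h; first by rewrite mem_set ?mulr1.
by rewrite memNset ?mulr0 // => H; move: h; rewrite H.
Qed.

Lemma scaled_cutoff_sqr k x : scaled_cutoff k x ^+ 2 =
  x ^+ 2 * ((x ^+ 2 <= k.+1%:R)%R)%:R / k.+1%:R.
Proof.
rewrite /scaled_cutoff expr_div_n sqr_sqrtr // cutoffE.
by case: ifP; rewrite ?mulr1 // expr0n mulr0.
Qed.

(** The cutoff level for index k (that is, for X_{k+1}) is x^2 <= k + 1, the
    largest for which the exponent has modulus at most 1. *)
Lemma scaled_cutoff_le1 k x : `|scaled_cutoff k x| <= 1.
Proof.
rewrite -sqrtr_sqr -sqrtr1 ler_wsqrtr // scaled_cutoff_sqr.
case: (leP (x ^+ 2)) => h; last by rewrite mulr0 mul0r ler01.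
by rewrite mulr1 ler_pdivrMr ?mul1r.
Qed.

Lemma scaled_cutoff_sqr_le k x : scaled_cutoff k x ^+ 2 <= k.+1%:R^-1 * x ^+ 2.
Proof.
rewrite scaled_cutoff_sqr mulrC ler_wpM2l ?invr_ge0 //.
by case: (leP (x ^+ 2)) => _; rewrite ?mulr1 // mulr0 sqr_ge0.
Qed.

Lemma scaled_cutoff_sum4 N x : \sum_(k < N) scaled_cutoff k x ^+ 4 <= 2 * x ^+ 2.
Proof.
have [->|x0] := eqVneq x 0.
  rewrite expr0n mulr0 big1 // => k _; rewrite (exprM _ 2 2) scaled_cutoff_sqr.
  by rewrite expr0n !mul0r expr0n.
have u0 : 0 < x ^+ 2 by rewrite exprn_even_gt0.
rewrite (eq_bigr (fun k : 'I_N =>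
    (x ^+ 2) ^+ 2 * (((x ^+ 2 <= k.+1%:R)%R)%:R / k.+1%:R ^+ 2))); last first.
  move=> k _; rewrite (exprM _ 2 2) scaled_cutoff_sqr !exprMn -mulrA exprVn.
  by case: (leP (x ^+ 2)) => _; rewrite ?expr1n ?expr0n.
rewrite -mulr_sumr; apply: le_trans (ler_wpM2l (sqr_ge0 _) (sum_inv_sqr_le N u0)) _.
apply: (@le_trans _ _ ((x ^+ 2) ^+ 2 * (2 / x ^+ 2))).
  by rewrite ler_wpM2l ?sqr_ge0 // gerBl divr_ge0 // le_max ler0n orbT.
by rewrite (_ : _ * _ = 2 * x ^+ 2) //; field.
Qed.

End Cutoff.

Section HMC.
Context d (T : measurableType d) (R : realType) (P : probability T R).
Variables (tau Rad : nat -> {RV P >-> R}).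
Hypothesis hX : hmc_input tau Rad.

Lemma integrable_sqr k : P.-integrable setT (EFin \o (fun w => Rad k w ^+ 2)).
Proof.
have [_ _ /(_ k) h _] := hX; apply/integrableP; split.
  by apply/measurable_EFinP/measurable_funX; exact: measurable_funPT.
under eq_integral => w _ do rewrite /= ger0_norm ?sqr_ge0 //.
by move: h; rewrite unlock => ->; rewrite ltry.
Qed.

Lemma Rintegral_sqr k : \int[P]_w (Rad k w ^+ 2) = 1.
Proof. by have [_ _ /(_ k) h _] := hX; move: h; rewrite unlock /Rintegral => ->. Qed.

Lemma Rintegral_identical k (g : R -> R) : measurable_fun setT g ->
  (forall x, 0 <= g x) -> \int[P]_w g (Rad k w) = \int[P]_w g (Rad 0%N w).
Proof.
move=> mg g0; have [_ [[_ idR] _] _ _] := hX; rewrite /Rintegral; congr fine.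
have mE : measurable_fun setT (fun x => (g x)%:E) by exact/measurable_EFinP.
have gE x : (0 <= (g x)%:E)%E by rewrite lee_fin.
have h j := ge0_integral_distribution (Rad j) mE gE.
have := h k; have := h 0%N; rewrite /comp /= => <- <-.
by apply: eq_measure_integral => A mA _; exact: idR.
Qed.

Lemma moment_scaled_cutoff1 k : moment Rad (@scaled_cutoff R) k 1 <= k.+1%:R^-1.
Proof.
have -> : k.+1%:R^-1 = \int[P]_w (k.+1%:R^-1 * Rad k w ^+ 2).
  by rewrite RintegralZl ?Rintegral_sqr ?mulr1 //; exact: integrable_sqr.
rewrite /moment muln1.
apply: le_Rintegral => //.
- apply: (bdd_integrable P (M := 1)) => [|w].
    apply: measurable_funX; apply: (measurableT_comp (measurable_scaled_cutoff k)).
    exact: measurable_funPT.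
  by rewrite normrX exprn_ile1 // scaled_cutoff_le1.
- apply: (eq_integrable _ _ _ _ (integrableZl _ k.+1%:R^-1 (integrable_sqr k))) => //.
- by move=> w _; apply: scaled_cutoff_sqr_le.
Qed.

Lemma moment_scaled_cutoff2_sum N :
  \sum_(k < N) moment Rad (@scaled_cutoff R) k 2 <= 2.
Proof.
have m4 k : measurable_fun setT (fun x : R => scaled_cutoff k x ^+ 4).
  by apply: measurable_funX; exact: measurable_scaled_cutoff.
have i4 k : P.-integrable setT (EFin \o (fun w => scaled_cutoff k (Rad 0%N w) ^+ 4)).
  apply: (bdd_integrable P (M := 1)) => [|w].
    by apply: (measurableT_comp (m4 k)); exact: measurable_funPT.
  by rewrite normrX exprn_ile1 // scaled_cutoff_le1.
have -> : \sum_(k < N) moment Rad (@scaled_cutoff R) k 2 =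
    \sum_(k < N) \int[P]_w (scaled_cutoff k (Rad 0%N w) ^+ 4).
  apply: eq_bigr => k _; rewrite /moment.
  by rewrite (@Rintegral_identical k (fun x => scaled_cutoff k x ^+ 4)) // => x;
    rewrite (exprM _ 2 2) sqr_ge0.
have [iS <-] := Rintegral_sum N i4.
have -> : 2 = 2 * \int[P]_w (Rad 0%N w ^+ 2) :> R by rewrite Rintegral_sqr mulr1.
rewrite -RintegralZl //; last exact: integrable_sqr.
apply: le_Rintegral => //.
- by apply: (eq_integrable _ _ _ _ (integrableZl _ 2 (integrable_sqr 0))).
- by move=> w _; apply: scaled_cutoff_sum4.
Qed.

(** Borel-Cantelli: the expected number of exceedances is at most
    \sum_k P(R^2 > k) <= E[R^2]. *)
Lemma ae_eventually_small :
  {ae P, forall w, exists K, forall k, (K <= k)%N -> Rad k w ^+ 2 <= k.+1%:R}.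
Proof.
pose v k (x : R) : R := ((k.+1%:R < x ^+ 2)%R)%:R.
have mv k : measurable_fun setT (v k).
  rewrite (_ : v k = \1_(~` small_set k)).
    by apply: measurable_indic; apply: measurableC; exact: measurable_small_set.
  apply/funext => x; rewrite /v indicE; congr (nat_of_bool _)%:R.
  rewrite ltNge; apply/idP/idP => [h|]; first by rewrite mem_set // => H; rewrite H in h.
  by rewrite inE => h; apply/negP.
have v0 k x : 0 <= v k x by rewrite ler0n.
have iv k j : P.-integrable setT (EFin \o (fun w => v k (Rad j w))).
  apply: (bdd_integrable P (M := 1)) => [|w].
    by apply: (measurableT_comp (mv k)); exact: measurable_funPT.
  by rewrite ger0_norm // lern1 leq_b1.
have bound : exists M, forall N, \sum_(k < N) \int[P]_w v k (Rad k w) <= M.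
  exists 1 => N; rewrite (eq_bigr (fun k : 'I_N => \int[P]_w v k (Rad 0%N w))); last first.
    by move=> k _; exact: Rintegral_identical.
  have [iS <-] := Rintegral_sum (u := fun k w => v k (Rad 0%N w)) N (fun k => iv k 0%N).
  rewrite -(Rintegral_sqr 0); apply: le_Rintegral => //; first exact: integrable_sqr.
  by move=> w _; apply: sum_indic_lt_le; exact: sqr_ge0.
apply: filterS (ae_bounded_sums (fun k w => v0 k (Rad k w)) (fun k => iv k k) bound).
move=> w [M hM].
(* infinitely many large terms would make the partial sums unbounded *)
apply: contrapT => H.
have inf K : exists2 k, (K <= k)%N & v k (Rad k w) = 1.
  apply: contrapT => H'; apply: H; exists K => k Kk; rewrite leNgt; apply/negP => h.
  by apply: H'; exists k => //; rewrite /v h.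
have big m : exists N, m%:R <= \sum_(k < N) v k (Rad k w).
  elim: m => [|m [N hN]]; first by exists 0%N; rewrite big_ord0.
  have [k Nk vk] := inf N; exists k.+1; rewrite big_ord_recr /= vk -natr1 lerD2r.
  apply: le_trans hN _; rewrite (big_ord_widen k (fun j => v j (Rad j w))) // big_mkcond.
  by apply: ler_sum => j _; case: ifP.
have [N] := big (Num.truncn M).+1.
by rewrite leNgt => /negP; apply; apply: le_lt_trans (hM N) (truncnS_gt _).
Qed.

Definition cutoff_input (w : T) k : R[i] := expi (tau k w) * (cutoff k (Rad k w))%:C%C.

Lemma hmc_exponent_cutoff w :
  hmc_exponent (cutoff_input w) = rotated tau Rad (@scaled_cutoff R) w.
Proof.
apply/funext => -[//|k]; rewrite /= /cutoff_input /scaled_cutoff -mulrA.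
by rewrite -fmorphV -rmorphM.
Qed.

(** The cut off chaos is in H^s because its weighted energy has finite
    expectation, and it differs from the original one in finitely many inputs. *)
Lemma hmc_sobolev s : s < - 2^-1 ->
  {ae P, forall w, HMC1_in_H s (fun k => hmcX tau Rad k w)}.
Proof.
move=> sh; have [[[itau _] utau] [[iRad _] _] _ irt] := hX.
pose B n w := normc (hmc_coef (cutoff_input w) n) ^+ 2.
have bB n : bdd_meas (fun w => hmc_coef (cutoff_input w) n).
  have := bdd_meas_coef_exp tau Rad (@measurable_scaled_cutoff R) (@scaled_cutoff_le1 R) n.
  by apply: eq_bdd_meas => w; rewrite /hmc_coef hmc_exponent_cutoff.
have B0 n w : 0 <= B n w by exact: sqr_ge0.
have iB n : P.-integrable setT (EFin \o B n).
  have [rB jB [M hM]] := bB n; apply: (bdd_integrable P (M := M ^+ 2)) => [|w].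
    have : measurable_fun setT (fun w => complex.Re (hmc_coef (cutoff_input w) n) ^+ 2 +
        complex.Im (hmc_coef (cutoff_input w) n) ^+ 2).
      by apply: measurable_funD; apply: measurable_funX.
    apply: eq_measurable_fun => w _; rewrite /B; case: (hmc_coef _ _) => a b /=.
    by rewrite sqr_sqrtr // addr_ge0 ?sqr_ge0.
  by rewrite ger0_norm // lerXn2r ?nnegrE ?normc_ge0 // (le_trans (normc_ge0 _) (hM w)).
have growth N : \sum_(n < N.+1) \int[P]_w B n w <= expR (expR 1 * 2) * N.+1%:R.
  have := second_moment_sum itau iRad irt utau (@measurable_scaled_cutoff R)
    (@scaled_cutoff_le1 R) N moment_scaled_cutoff1.
  rewrite (eq_bigr (fun n : 'I_N.+1 => \int[P]_w B n w)) => [h|n _]; last first.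
    by apply: eq_Rintegral => w _; rewrite /B /hmc_coef hmc_exponent_cutoff.
  apply: le_trans h _; rewrite ler_wpM2r // ler_expR ler_wpM2l ?expR_ge0 //.
  exact: moment_scaled_cutoff2_sum.
have s0 : s <= 0 by lra.
pose u n w := sobolev_weight s n * B n w.
have iu n : P.-integrable setT (EFin \o u n).
  by apply: (eq_integrable _ _ _ _ (integrableZl _ (sobolev_weight s n) (iB n))).
have u0 n w : 0 <= u n w by rewrite mulr_ge0 // sobolev_weight_ge0.
have EB0 n : 0 <= \int[P]_w B n w by apply: Rintegral_ge0.
have bound : exists M, forall N, \sum_(n < N) \int[P]_w u n w <= M.
  have [M hM] := linear_growth_summable sh EB0 growth; exists M => N.
  apply: le_trans (hM N); apply: ler_sum => n _.
  by rewrite RintegralZl.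
apply: filterS2 (ae_bounded_sums u0 iu bound) ae_eventually_small => w hw [K hK].
apply: (HMC1_in_H_finite_change (K := K) (Y := cutoff_input w)) => //.
  by move=> k Kk; rewrite /hmcX /cutoff_input cutoffE hK.
exact/HMC1_in_HP.
Qed.

End HMC.

Theorem corollary1p6 (R : realType) (d : measure_display) (T : measurableType d)
    (P : probability T R) (tau Rad : nat -> {RV P >-> R})
    (hX : hmc_input tau Rad) :
  ((exists2 g : R, 2 < g &
      ('E_P[fun w => expR (g * normc (hmcX tau Rad 0%N w))] < +oo)%E) ->
    forall s : R, s < - 2^-1 ->
      {ae P, forall w, HMC1_in_H s (fun k => hmcX tau Rad k w)})
  /\
  (forall g : R, 0 < g -> g <= 2 ->
    (forall (k : nat) (u : R), 0 < u ->
      P [set w | u <= normc (hmcX tau Rad k w)] =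
      (Num.min 1 (expR (- g * (u - c_shift g))))%:E) ->
    forall s : R, s < - g^-1 ->
      {ae P, forall w, HMC1_in_H s (fun k => hmcX tau Rad k w)}).
Proof.
split=> [_ s|g g0 g2 _ s sg]; first exact: hmc_sobolev.
by apply: (hmc_sobolev hX); apply: lt_le_trans sg _; rewrite lerN2 lef_pV2 ?posrE.
Qed.
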